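(* Let $\mathcal{D}$ be a dense linear subspace of a complex Hilbert space $\mathscr{H}$ and $A$ a commutative $^*$-subalgebra of $\mathcal{L}^*(\mathcal{D})$. Assume that every element of $\mathbb{1}+A_{\mathrm{h}}^+$ is essentially selfadjoint (as a densely defined operator on $\mathscr{H}$). Then $A_{\mathrm{h}}$ with the operator order is a localizable archimedean partially ordered commutative ring, and the extended Gelfand transformation $\widehat{\cdot}\colon A_{\mathrm{h}}\to\mathscr{C}_{\mathrm{a.e.}}(\mathcal{K}(A_{\mathrm{h}}))$ is a positive ring morphism and an order embedding.
   Context: $\mathcal{L}^*(\mathcal{D})$ is the set of maps $a\colon\mathcal{D}\to\mathcal{D}$ for which there is $a^*\colon\mathcal{D}\to\mathcal{D}$ with $\langle\phi,a\psi\rangle=\langle a^*\phi,\psi\rangle$ for all $\phi,\psi\in\mathcal{D}$ (inner product antilinear in the first argument); it is a unital $^*$-algebra under pointwise linear operations, composition and $a\mapsto a^*$, with unit $\mathbb{1}=\mathrm{id}_{\mathcal{D}}$. A $^*$-subalgebra contains $\mathbb{1}$ and is closed under $^*$. $A_{\mathrm{h}}=\{a\in A:a^*=a\}$, a commutative ring, with the operator order $a\le b$ iff $\langle\phi,a\phi\rangle\le\langle\phi,b\phi\rangle$ for all $\phi\in\mathcal{D}$; $A_{\mathrm{h}}^+=\{a:0\le a\}$. All rings are commutative with unit; ring morphisms are unital. A partially ordered commutative ring is a commutative ring $R$ with a partial order $\le$ with $r\le s\Rightarrow r+t\le s+t$, and $R^+$ closed under multiplication and containing all squares. A ring morphism is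 positive if it maps positive elements to positive elements, an order embedding if moreover elements with positive image are positive. $\mathbb{N}=\{1,2,\dots\}$, $\mathbb{N}_0=\mathbb{N}\cup\{0\}$. $R$ is archimedean if $kg+h\in R^+$ for all $k\in\mathbb{N}$ implies $g\in R^+$. $\mathrm{Loc}(R)$ is the set of $s\in1+R^+$ with: $rs\in R^+\Rightarrow r\in R^+$ for all $r$; $R$ is localizable if each $r$ satisfies $-s\le r\le s$ for some $s\in\mathrm{Loc}(R)$. For a topological space $X$: $\mathscr{C}_{\mathrm{a.e.}}(X)$ is the set of continuous real functions defined on dense open subsets of $X$ modulo agreement on a dense open subset of the common domain, with pointwise operations on the intersection of domains and order $[f]\le[g]$ iff $f\le g$ on some dense open subset of $\operatorname{dom}f\cap\operatorname{dom}g$. $R_{\mathrm{loc}}$: fractions $r/s$ ($r\in R$, $s\in\mathrm{Loc}(R)$), $r/s=r'/s'$ iff $rs'=r's$, ordered by $p/q\le r/s$ iff $ps\le rq$. $R^{\mathrm{bd}}_{\mathrm{loc}}=\{a:\exists n\in\mathbb{N}_0,\ -n\le a\le n\}$. $\mathcal{K}(R)$: ring morphisms $\varphi\colon R^{\mathrm{bd}}_{\mathrm{loc}}\to\mathbb{R}$ with $\varphi(a)\ge0$ for $a\ge0$, weak-$*$ topology. $\mathrm{O}_{s<\infty}=\{\varphi:\varphi(1/s)>0\}$; for archimedean localizable $R$ these are dense open in $\mathcal{K}(R)$. The extended Gelfand transformation sends $r$ to the class $\widehat r\in\mathscr{C}_{\mathrm{a.e.}}(\mathcal{K}(R))$ of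 $r_s\colon\mathrm{O}_{s<\infty}\to\mathbb{R}$, $\varphi\mapsto\varphi(1/s)^{-1}\varphi(r/s)$, for any $s\in\mathrm{Loc}(R)$ with $r/s\in R^{\mathrm{bd}}_{\mathrm{loc}}$. *)

(* Defs.v *)
From HB Require Import structures.
From mathcomp Require Import all_boot all_order all_algebra.
From mathcomp Require Import boolp classical_sets reals complex.
Set Implicit Arguments. Unset Strict Implicit. Unset Printing Implicit Defensive.
Import Order.TTheory GRing.Theory Num.Theory.
Local Open Scope ring_scope.
Local Open Scope classical_set_scope.

Section POring.
Variables (Rg : comPzRingType) (le : Rg -> Rg -> Prop).

Definition pos (r : Rg) : Prop := le 0 r.

Definition po_comring : Prop :=
  [/\ (forall r, le r r) /\ (forall r s, le r s -> le s r -> r = s)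
          /\ (forall r s t, le r s -> le s t -> le r t),
      (forall r s t, le r s -> le (r + t) (s + t)),
      (forall r s, pos r -> pos s -> pos (r * s)) &
      (forall r, pos (r * r))].

Definition archimedean : Prop :=
  forall g h : Rg, (forall k : nat, (0 < k)%N -> pos (g *+ k + h)) -> pos g.

Definition Loc (s : Rg) : Prop :=
  (exists2 p, pos p & s = 1 + p) /\ (forall r, pos (r * s) -> pos r).

Definition localizable : Prop :=
  forall r : Rg, exists s, [/\ Loc s, le (- s) r & le r s].

(* Fractions r/s are represented by pairs (r, s) with s in Loc(R). *)
Definition frac := (Rg * Rg)%type.
Definition is_frac (x : frac) : Prop := Loc x.2.
Definition frac_eq (x y : frac) : Prop := x.1 * y.2 = y.1 * x.2.
Definition frac_le (x y : frac) : Prop := le (x.1 * y.2) (y.1 * x.2).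
Definition frac_add (x y : frac) : frac := (x.1 * y.2 + y.1 * x.2, x.2 * y.2).
Definition frac_mul (x y : frac) : frac := (x.1 * y.1, x.2 * y.2).
Definition frac_of (r : Rg) : frac := (r, 1).

Definition bdloc (x : frac) : Prop :=
  is_frac x /\ exists n : nat,
    frac_le (frac_of (- n%:R)) x /\ frac_le x (frac_of n%:R).

Variable RR : realType.

(* K(R): positive unital ring morphisms R^bd_loc -> RR.  A morphism is     *)
(* encoded as a function on representing pairs which is constant on        *)
(* equivalence classes of bounded fractions and (normalization) vanishes   *)
(* on pairs that do not represent an element of R^bd_loc; this gives a     *)
(* bijection with the ring morphisms R^bd_loc -> RR.                       *)
Definition character (phi : frac -> RR) : Prop :=
  [/\ (forall x, ~ bdloc x -> phi x = 0),
      (forall x y, bdloc x -> bdloc y -> frac_eq x y -> phi x = phi y),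
      (forall x y, bdloc x -> bdloc y ->
          phi (frac_add x y) = phi x + phi y /\
          phi (frac_mul x y) = phi x * phi y),
      phi (frac_of 1) = 1 &
      (forall x, bdloc x -> frac_le (frac_of 0) x -> 0 <= phi x)].

Definition KR : set (frac -> RR) := [set phi | character phi].

Definition Kopen (U : set (frac -> RR)) : Prop :=
  U `<=` KR /\
  forall phi, U phi -> exists (xs : seq frac) (e : RR), 0 < e /\
    forall psi, KR psi -> (forall x, x \in xs -> `|psi x - phi x| < e) -> U psi.

Definition dense_in (W U : set (frac -> RR)) : Prop :=
  W `<=` U /\ forall V, Kopen V -> V `&` U !=set0 -> W `&` V !=set0.

Definition Kcont (U : set (frac -> RR)) (f : (frac -> RR) -> RR) : Prop :=
  forall phi, U phi -> forall e : RR, 0 < e ->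
    exists V, [/\ Kopen V, V phi &
       forall psi, V psi -> U psi -> `|f psi - f phi| < e].

(* Representatives of elements of C_a.e.(K(R)): a domain and a function.   *)
Definition aefun := (set (frac -> RR) * ((frac -> RR) -> RR))%type.

Definition ae_valid (F : aefun) : Prop :=
  [/\ Kopen F.1, dense_in F.1 KR & Kcont F.1 F.2].

Definition ae_eq (F G : aefun) : Prop :=
  exists W, [/\ Kopen W, dense_in W (F.1 `&` G.1) &
                forall phi, W phi -> F.2 phi = G.2 phi].
Definition ae_le (F G : aefun) : Prop :=
  exists W, [/\ Kopen W, dense_in W (F.1 `&` G.1) &
                forall phi, W phi -> F.2 phi <= G.2 phi].

Definition ae_add (F G : aefun) : aefun :=
  (F.1 `&` G.1, fun phi => F.2 phi + G.2 phi).
Definition ae_mul (F G : aefun) : aefun :=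
  (F.1 `&` G.1, fun phi => F.2 phi * G.2 phi).
Definition ae_const (c : RR) : aefun := (KR, fun _ => c).

Definition Os (s : Rg) : set (frac -> RR) :=
  [set phi | KR phi /\ 0 < phi (1, s)].

Definition gel_adm (r s : Rg) : Prop := Loc s /\ bdloc (r, s).

Definition gel (r s : Rg) : aefun :=
  (Os s, fun phi => (phi (1, s))^-1 * phi (r, s)).

Definition gelfand_well_defined : Prop :=
  [/\ (forall r, exists s, gel_adm r s),
      (forall r s, gel_adm r s -> ae_valid (gel r s)) &
      (forall r s s', gel_adm r s -> gel_adm r s' -> ae_eq (gel r s) (gel r s'))].

Definition gelfand_ring_morphism : Prop :=
  [/\ (forall r t s1 s2 s3, gel_adm r s1 -> gel_adm t s2 -> gel_adm (r + t) s3 ->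
          ae_eq (gel (r + t) s3) (ae_add (gel r s1) (gel t s2))),
      (forall r t s1 s2 s3, gel_adm r s1 -> gel_adm t s2 -> gel_adm (r * t) s3 ->
          ae_eq (gel (r * t) s3) (ae_mul (gel r s1) (gel t s2))) &
      (forall s, gel_adm 1 s -> ae_eq (gel 1 s) (ae_const 1))].

Definition gelfand_positive : Prop :=
  forall r s, gel_adm r s -> pos r -> ae_le (ae_const 0) (gel r s).

Definition gelfand_order_embedding : Prop :=
  gelfand_positive /\
  forall r s, gel_adm r s -> ae_le (ae_const 0) (gel r s) -> pos r.

End POring.

Section Hilbert.
Variable R : realType.
Local Notation C := R[i].
Variables (H : lmodType C) (ip : H -> H -> C).

Definition hnorm (x : H) : C := sqrtC (ip x x).

Record is_hilbert : Prop := IsHilbert {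
  ip_linr : forall (x y z : H) (a : C), ip x (a *: y + z) = a * ip x y + ip x z;
  ip_conj : forall x y, ip y x = conjc (ip x y);
  ip_ge0 : forall x, 0 <= ip x x;
  ip_def : forall x, ip x x = 0 -> x = 0;
  ip_complete : forall u : nat -> H,
    (forall e : C, 0 < e -> exists N, forall m n, (N <= m)%N -> (N <= n)%N ->
        hnorm (u m - u n) < e) ->
    exists l, forall e : C, 0 < e -> exists N, forall n, (N <= n)%N ->
        hnorm (u n - l) < e
}.

(* D is a dense linear subspace of H: given via an injective linear map j. *)
Variables (D : lmodType C) (j : {linear D -> H}).

Definition dense_subspace : Prop :=
  injective j /\ forall (x : H) (e : C), 0 < e -> exists d : D, hnorm (x - j d) < e.

Definition ipD (phi psi : D) : C := ip (j phi) (j psi).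

Definition is_adjoint (a b : D -> D) : Prop :=
  forall phi psi, ipD phi (a psi) = ipD (b phi) psi.
Definition selfadjoint (a : D -> D) : Prop := is_adjoint a a.

Record comm_star_subalg (A : set (D -> D)) : Prop := CommStarSubalg {
  csa_adj : forall a, A a -> exists2 b, A b & is_adjoint a b;
  csa_one : A id;
  csa_add : forall a b, A a -> A b -> A (fun x => a x + b x);
  csa_scale : forall (c : C) a, A a -> A (fun x => c *: a x);
  csa_mul : forall a b, A a -> A b -> A (a \o b);
  csa_comm : forall a b, A a -> A b -> a \o b = b \o a
}.

Definition opleq (a b : D -> D) : Prop :=
  forall phi, ipD phi (a phi) <= ipD phi (b phi).

Definition graph_closure (G : H -> H -> Prop) (x y : H) : Prop :=
  forall e : C, 0 < e -> exists x' y', [/\ G x' y', hnorm (x - x') < e & hnorm (y - y') < e].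
Definition adj_graph (G : H -> H -> Prop) (y z : H) : Prop :=
  forall x w, G x w -> ip w y = ip x z.
Definition op_graph (a : D -> D) (x y : H) : Prop :=
  exists d, x = j d /\ y = j (a d).

Definition ess_selfadjoint (a : D -> D) : Prop :=
  forall x y, graph_closure (op_graph a) x y <->
              adj_graph (graph_closure (op_graph a)) x y.

Section Ah.
Variables (hH : is_hilbert) (A : set (D -> D)) (hA : comm_star_subalg A).

Record AhT := MkAh { ahval : D -> D; ahP : A ahval /\ selfadjoint ahval }.

Lemma ah_inj (x y : AhT) : ahval x = ahval y -> x = y.
Proof.
case: x y => [f hf] [g hg] /= e; subst g; congr MkAh; exact: Prop_irrelevance.
Qed.


Lemma ipDr x y z : ip x (y + z) = ip x y + ip x z.
Proof. by have := ip_linr hH x y z 1; rewrite scale1r mul1r. Qed.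
Lemma ip0r x : ip x 0 = 0.
Proof. by have /eqP := ipDr x 0 0; rewrite addr0 -subr_eq addrN eq_sym => /eqP. Qed.
Lemma ipNr x y : ip x (- y) = - ip x y.
Proof. by have := ip_linr hH x y 0 (-1); rewrite addr0 scaleN1r ip0r addr0 mulN1r. Qed.
Lemma ipDl x y z : ip (y + z) x = ip y x + ip z x.
Proof. by rewrite !((ip_conj hH) x) ipDr raddfD. Qed.
Lemma ip0l x : ip 0 x = 0.
Proof. by rewrite ((ip_conj hH) x) ip0r raddf0. Qed.
Lemma ipNl x y : ip (- y) x = - ip y x.
Proof. by rewrite !((ip_conj hH) x) ipNr raddfN. Qed.

Let zeroP : A (fun _ : D => 0) /\ selfadjoint (fun _ : D => 0).
Proof.
split.
  have -> : (fun _ : D => 0) = (fun x : D => 0 *: id x).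
    by apply: funext => x; rewrite scale0r.
  exact: (csa_scale hA 0 (csa_one hA)).
by move=> phi psi; rewrite /ipD !linear0 ip0r ip0l.
Qed.
Definition ah0 := MkAh zeroP.

Let oppP (a : AhT) : A (fun x => - ahval a x) /\ selfadjoint (fun x => - ahval a x).
Proof.
case: a => f [Af sf] /=; split.
  have -> : (fun x => - f x) = (fun x => (-1) *: f x).
    by apply: funext => x; rewrite scaleN1r.
  exact: (csa_scale hA).
move=> phi psi; have := sf phi psi.
by rewrite /ipD !linearN ipNr ipNl => ->.
Qed.
Definition ahopp (a : AhT) := MkAh (oppP a).

Let addP (a b : AhT) : A (fun x => ahval a x + ahval b x) /\
                       selfadjoint (fun x => ahval a x + ahval b x).
Proof.
case: a b => f [Af sf] [g [Ag sg]] /=; split; first exact: (csa_add hA).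
move=> phi psi; have := sf phi psi; have := sg phi psi.
by rewrite /ipD !linearD ipDr ipDl => -> ->.
Qed.
Definition ahadd (a b : AhT) := MkAh (addP a b).

Let oneP : A id /\ selfadjoint id.
Proof. by split; [exact: (csa_one hA) | move=> ? ?]. Qed.
Definition ah1 := MkAh oneP.

Let mulP (a b : AhT) : A (ahval a \o ahval b) /\ selfadjoint (ahval a \o ahval b).
Proof.
case: a b => f [Af sf] [g [Ag sg]] /=; split; first exact: (csa_mul hA).
move=> phi psi /=; rewrite sf sg.
by have := congr1 (fun h => h phi) (csa_comm hA Af Ag) => /= ->.
Qed.
Definition ahmul (a b : AhT) := MkAh (mulP a b).

(* The carrier of the ring A_h (depends on the hypotheses hH, hA that make *)
(* its ring operations well defined).                                      *)
Definition Ah : Type := let _ := hH in let _ := hA in AhT.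

HB.instance Definition _ := gen_eqMixin Ah.
HB.instance Definition _ := gen_choiceMixin Ah.

Lemma ah_addA : @associative Ah ahadd.
Proof. by move=> a b c; apply: ah_inj; apply: funext => x /=; rewrite addrA. Qed.
Lemma ah_addC : @commutative Ah Ah ahadd.
Proof. by move=> a b; apply: ah_inj; apply: funext => x /=; rewrite addrC. Qed.
Lemma ah_add0 : @left_id Ah Ah ah0 ahadd.
Proof. by move=> a; apply: ah_inj; apply: funext => x /=; rewrite add0r. Qed.
Lemma ah_addN : @left_inverse Ah Ah Ah ah0 ahopp ahadd.
Proof. by move=> a; apply: ah_inj; apply: funext => x /=; rewrite addNr. Qed.

HB.instance Definition _ := GRing.isZmodule.Build Ah ah_addA ah_addC ah_add0 ah_addN.

Lemma ah_mulA : @associative Ah ahmul.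
Proof. by move=> a b c; apply: ah_inj. Qed.
Lemma ah_mulC : @commutative Ah Ah ahmul.
Proof.
move=> a b; apply: ah_inj; case: a b => f [Af _] [g [Ag _]] /=; exact: (csa_comm hA).
Qed.
Lemma ah_mul1 : @left_id Ah Ah ah1 ahmul.
Proof. by move=> a; apply: ah_inj. Qed.
Lemma ah_mulDl : @left_distributive Ah Ah ahmul ahadd.
Proof. by move=> a b c; apply: ah_inj. Qed.

HB.instance Definition _ :=
  GRing.Zmodule_isComPzRing.Build Ah ah_mulA ah_mulC ah_mul1 ah_mulDl.

Definition Ah_le (a b : Ah) : Prop := opleq (ahval a) (ahval b).

End Ah.
End Hilbert.

(* Main.v *)
(* Essential selfadjointness of 1 + a, for a >= 0, makes the range of 1 + a     *)

(* The analytic input is [range_dense]: density of the range of [1 + a] stands in for a missing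
   inverse, and [Ah_pos_div] turns it into cancellation of (1 + a)^2 from positive elements. The
   order is tested on single vectors, so sums of positive elements, q^2 p for p positive, and the
   archimedean property cause no trouble. Products are the difficulty: positive commuting unbounded
   operators need not have a positive product. [prod_pos_of_archimedean] derives closure under
   products algebraically from cancellation and the archimedean property. After that, 1 + r^2 lies
   in [Loc] and dominates r and -r.

   For the abstract half, a bounded element that is not positive is negative at some character
   ([exists_negative_character]): it stays nonpositive after a small upward shift, the negative of
   the shifted element lies in a maximal cone, this cone is total, and a total cone cuts out one
   real number per bounded element. [exists_character_lt0] carries this over to pairs representing
   fractions. The sets {g > 0}, g a bounded fraction, form a base of the topology
   ([neighbourhood_fraction]), which gives [Os_dense]. If r is not positive, r/s is negative on a
   nonempty open set; by density this set meets {1/s > 0}, where the transform of r is then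
   negative. *)
(* dense.  Applied to (1 + a) (1 + r^2) = 1 + (a + r (1 + a) r), it provides     *)
(* approximations of every vector by vectors (1 + a) d in the graph norm of r,   *)
(* so (1 + a)^2 r >= 0 implies r >= 0.  Riesz's identity b = sum_k b_k^2 for     *)
(* b_0 = b, b_(k+1) = b_k - b_k^2, applied to b = a / (1 + a)^2 and combined     *)
(* with the archimedean property, then shows that a product of two positive      *)
(* elements is positive, so that Loc(A_h) = 1 + A_h^+.                           *)
(* The rest holds in any archimedean localizable partially ordered commutative   *)
(* ring: the Kadison-Dubois theorem yields enough characters of the bounded      *)
(* fractions to detect positivity, and the definition of Loc then makes the      *)
(* sets {1/s > 0} dense and the extended Gelfand transformation an order         *)
(* embedding.                                                                    *)
Require Import Defs.
From HB Require Import structures.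
From mathcomp Require Import all_boot all_order all_algebra.
From mathcomp Require Import generic_quotient ring lra.
From mathcomp Require Import boolp classical_sets reals complex.
Set Implicit Arguments. Unset Strict Implicit. Unset Printing Implicit Defensive.
Import Order.TTheory GRing.Theory Num.Theory.
Local Open Scope ring_scope.
Local Open Scope classical_set_scope.

(** * Products of positive elements *)

Section ProductOfPositives.
Variables (R : comPzRingType) (P : R -> Prop).
Hypotheses (PD : forall x y, P x -> P y -> P (x + y))
  (Psq : forall q x, P x -> P (q * q * x)) (P1 : P 1)
  (Phalf : forall x, P (x *+ 2) -> P x)
  (Parch : forall g h, (forall k, (0 < k)%N -> P (g *+ k + h)) -> P g)
  (Pdiv : forall a r, P a -> P ((1 + a) * (1 + a) * r) -> P r).

Variables (a p : R).
Hypotheses (Pa : P a) (Pp : P p).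

(* With b_0 = a / (1 + a)^2 and b_(k+1) = b_k - b_k^2, the fraction b_n is    *)
(* c_n / t_n^2, the sum of the b_k^2 over k < n is sigma_n / t_n^2, and       *)
(* f_n = (t_n / t_0)^2, where (t_n, c_n, sigma_n, g_n) = prod_iter n and      *)
(* f_n = g_n^2.                                                               *)
Let step (x : R * R * R * R) : R * R * R * R :=
  let: (t, c, sg, g) := x in
  (t * t, c * (t * t - c), t * t * sg + c * c, t * g).
Let prod_iter n := iter n step (1 + a, a, 0, 1).

Let sqrP x : P (x * x).
Proof. by rewrite -[_ * _]mulr1; exact: Psq. Qed.

Let mulnP x n : P x -> P (x *+ n).
Proof.
move=> Px; elim: n => [|n IH]; last by rewrite mulrSr; exact: PD.
by rewrite mulr0n -(mul0r 0); exact: sqrP.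
Qed.

Let prod_iterP n : let: (t, c, sg, g) := prod_iter n in
  [/\ P (t - 1), P c & P (t * t - c)] /\
  [/\ t = (1 + a) * g, g * g * a = sg + c, P (sg * p) &
      P (t * t * sg - c * c *+ n)].
Proof.
elim: n => [|n]; rewrite /prod_iter /=.
  have E : (1 + a) * (1 + a) - a = 1 + a + a * a by ring.
  split; split.
  - by rewrite addrC addKr.
  - by [].
  - by rewrite E; apply: PD => //; exact: PD.
  - by rewrite mulr1.
  - by ring.
  - by rewrite mul0r -(mul0r 0).
  - by rewrite mulr0 mulr0n subr0 -(mul0r 0).
rewrite -/(prod_iter n); case: (prod_iter n) => [[[t c] sg] g] /=.
case=> [[Pt Pc Pe] [tE fE Pps Pn]].
set e := t * t in Pe Pn *.
(* Since e = c + (e - c), the product e * c * (e - c) is a sum of squares times positive elements,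
   and the square e = t * t cancels by [Pdiv]. *)
have Pc' : P (c * (e - c)).
  apply: (Pdiv Pt); rewrite addrC subrK -/e.
  have -> : e * (c * (e - c)) = c * c * (e - c) + (e - c) * (e - c) * c by ring.
  by apply: PD; exact: Psq.
split; split.
- have -> : e - 1 = (t - 1) * (t - 1) + (t - 1) *+ 2 by rewrite /e; ring.
  by apply: PD => //; exact: mulnP.
- by [].
- have -> : e * e - c * (e - c) = t * t * (e - c) + c * c by rewrite /e; ring.
  by apply: PD => //; exact: Psq.
- by rewrite /e {1}tE; ring.
- have -> : t * g * (t * g) * a = e * (g * g * a) by rewrite /e; ring.
  by rewrite fE; ring.
- by rewrite mulrDl -mulrA; apply: PD; exact: Psq.
(* In terms of the b_k: n b_n^2 is at most the sum of the earlier squares, and the bound passes to n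
   + 1 because b_(n+1)^2 <= b_n^2. *)
- have -> : e * e * (e * sg + c * c) - c * (e - c) * (c * (e - c)) *+ n.+1 =
            e * e * (e * sg - c * c *+ n) +
            (c * c * (t * t * c + c * (e - c))) *+ n.+1.
    rewrite -/e mulrS; ring.
  by apply: PD; [exact: Psq | apply/mulnP/Psq/PD => //; exact: Psq].
Qed.

Lemma prod_pos_of_archimedean : P (a * p).
Proof.
apply: Phalf.
(* For n = m^2, n b_n^2 <= sum_(k<n) b_k^2 <= 1 gives (m b_n)^2 <= 1, so 2 m b_n p >= -(m b_n)^2 -
   p^2 >= -(1 + p^2). As b_0 - b_n is a sum of squares, 2 m b_0 p + 1 + p^2 >= 0; multiplication by
   (1 + a)^2 produces this [h]. *)
apply: (Parch (h := (1 + a) * (1 + a) * (1 + p * p))) => m _.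
have := prod_iterP (m * m); case: (prod_iter _) => [[[t c] sg] g].
case=> [[Pt Pc Pe] [tE fE Pps Pn]].
apply: (Pdiv (a := t * t - 1)).
  have -> : t * t - 1 = (t - 1) * (t - 1) + (t - 1) *+ 2 by ring.
  by apply: PD => //; exact: mulnP.
have -> : 1 + (t * t - 1) = t * t by ring.
have Pse : P (t * t - sg).
  have -> : t * t - sg = g * g * ((1 + a) * (1 + a) - a) + c.
    by rewrite mulrBr fE tE; ring.
  apply: PD => //; apply: Psq.
  have -> : (1 + a) * (1 + a) - a = 1 + a + a * a by ring.
  by apply: PD => //; exact: PD.
have Pee : P (t * t * (t * t) - c * c *+ (m * m)).
  have -> : t * t * (t * t) - c * c *+ (m * m) =
    t * t * (t * t - sg) + (t * t * sg - c * c *+ (m * m)) by ring.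
  by apply: PD => //; exact: Psq.
have -> : t * t * (t * t) * (a * p *+ 2 *+ m + (1 + a) * (1 + a) * (1 + p * p)) =
  (1 + a) * (1 + a) * ((t * t * (sg * p)) *+ (2 * m) +
   ((c *+ m + t * t * p) * (c *+ m + t * t * p)
    + (t * t * (t * t) - c * c *+ (m * m)))).
  have E : t * t * (a * p) = (1 + a) * (1 + a) * ((sg + c) * p).
    by rewrite -fE tE; ring.
  have -> : t * t * (t * t) * (a * p *+ 2 *+ m + (1 + a) * (1 + a) * (1 + p * p))
    = t * t * (t * t * (a * p)) *+ 2 *+ m + t * t * (t * t) * ((1 + a) * (1 + a) * (1 + p * p)).
    by ring.
  by rewrite E; ring.
by apply: Psq; apply: PD; [apply/mulnP/Psq | exact: PD].
Qed.

End ProductOfPositives.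

(** * Real inner product *)

Lemma le0_eps (R : realFieldType) (x c : R) :
  (forall e, 0 < e -> x <= c * e) -> x <= 0.
Proof.
move=> h; apply/ler_addgt0Pr => e e0; rewrite add0r.
have c1 : 0 < `|c| + 1 by apply: ltr_wpDl.
apply: le_trans (h (e / (`|c| + 1)) _) _; first exact: divr_gt0.
rewrite mulrCA ger_pMr // ler_pdivrMr // mul1r.
by have := ler_norm c; lra.
Qed.

Section RealInnerProduct.
Variables (R : realType) (H : lmodType R[i]) (ip : H -> H -> R[i]).
Hypothesis hH : is_hilbert ip.

Definition rip x y : R := complex.Re (ip x y).
Definition rnorm x : R := Num.sqrt (rip x x).

Lemma ipZr a x y : ip x (a *: y) = a * ip x y.
Proof. by rewrite -[a *: y]addr0 (ip_linr hH) (ip0r hH) addr0. Qed.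

Lemma ipZl a x y : ip (a *: x) y = conjc a * ip x y.
Proof.
by rewrite (ip_conj hH) ipZr rmorphM /= -(ip_conj hH).
Qed.

Lemma ripC x y : rip x y = rip y x.
Proof. by rewrite /rip (ip_conj hH x y); case: (ip x y). Qed.

Lemma ripDr x y z : rip x (y + z) = rip x y + rip x z.
Proof. by rewrite /rip (ipDr hH) raddfD. Qed.

Lemma ripNr x y : rip x (- y) = - rip x y.
Proof. by rewrite /rip (ipNr hH) raddfN. Qed.

Lemma ripDl x y z : rip (y + z) x = rip y x + rip z x.
Proof. by rewrite ripC ripDr !(ripC x). Qed.

Lemma ripNl x y : rip (- y) x = - rip y x.
Proof. by rewrite ripC ripNr ripC. Qed.

Lemma ripZr a x y : rip x (a%:C%C *: y) = a * rip x y.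
Proof.
rewrite /rip ipZr.
by case: (ip x y) => u v /=; rewrite mul0r subr0.
Qed.

Lemma ripZl a x y : rip (a%:C%C *: x) y = a * rip x y.
Proof. by rewrite ripC ripZr ripC. Qed.

Lemma rip0l x : rip 0 x = 0.
Proof. by rewrite /rip (ip0l hH). Qed.

Lemma ip_rip x : ip x x = (rip x x)%:C%C.
Proof. by rewrite /rip RRe_real // ger0_real // (ip_ge0 hH). Qed.

Lemma rip_ge0 x : 0 <= rip x x.
Proof. by have := ip_ge0 hH x; rewrite ip_rip ler0c. Qed.

Lemma rip_eq0 x : rip x x = 0 -> x = 0.
Proof. by move=> h; apply: (ip_def hH); rewrite ip_rip h. Qed.

Lemma rnorm_ge0 x : 0 <= rnorm x.
Proof. exact: sqrtr_ge0. Qed.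

Lemma sqr_rnorm x : rnorm x ^+ 2 = rip x x.
Proof. by rewrite sqr_sqrtr // rip_ge0. Qed.

Lemma rnorm_eq0 x : rnorm x = 0 -> x = 0.
Proof. by move=> h; apply: rip_eq0; rewrite -sqr_rnorm h expr0n. Qed.

Lemma hnormE x : hnorm ip x = (rnorm x)%:C%C.
Proof.
rewrite /hnorm ip_rip -sqr_rnorm rmorphXn /= sqrCK //.
by rewrite ler0c rnorm_ge0.
Qed.

Lemma hnorm_ltP x (e : R[i]) : 0 < e -> (hnorm ip x < e) = (rnorm x < complex.Re e).
Proof. by rewrite hnormE !ltcE /= => /andP[/eqP -> _]; rewrite eqxx. Qed.

Lemma ltr0Re (e : R[i]) : 0 < e -> 0 < complex.Re e.
Proof. by rewrite ltcE => /andP[]. Qed.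

Lemma rip_le x y : rip x y <= rnorm x * rnorm y.
Proof.
have [y0|y0] := eqVneq (rnorm y) 0.
  by rewrite (rnorm_eq0 y0) ripC rip0l mulr_ge0 ?rnorm_ge0.
have yp : 0 < rnorm y by rewrite lt_def y0 rnorm_ge0.
have [x0|x0] := eqVneq (rnorm x) 0.
  by rewrite (rnorm_eq0 x0) rip0l mulr_ge0 ?rnorm_ge0.
have xp : 0 < rnorm x by rewrite lt_def x0 rnorm_ge0.
have := rip_ge0 ((rnorm y)%:C%C *: x - (rnorm x)%:C%C *: y).
rewrite ripDr !ripDl !ripNr !ripNl !ripZl !ripZr -!sqr_rnorm (ripC y x) => h.
rewrite -(ler_pM2l xp) -(ler_pM2l yp).
by move: h; set u := rnorm x; set v := rnorm y; set w := rip x y; nra.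
Qed.

Lemma rnormN x : rnorm (- x) = rnorm x.
Proof. by rewrite /rnorm ripNl ripNr opprK. Qed.

Lemma ler_rip x y : `|rip x y| <= rnorm x * rnorm y.
Proof. by rewrite ler_norml rip_le lerNl -ripNl -(rnormN x) rip_le. Qed.

Lemma ler_rnormD x y : rnorm (x + y) <= rnorm x + rnorm y.
Proof.
rewrite -ler_sqr ?nnegrE ?addr_ge0 ?rnorm_ge0 // sqrrD !sqr_rnorm.
rewrite ripDr !ripDl (ripC y x); have := rip_le x y; lra.
Qed.

Lemma rnormZi x : rnorm ('i%C *: x) = rnorm x.
Proof.
by rewrite /rnorm /rip ipZl ipZr ip_rip; congr Num.sqrt; rewrite /=; ring.
Qed.

Lemma ip_eq0 x y : rip x y = 0 -> rip ('i%C *: x) y = 0 -> ip x y = 0.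
Proof.
rewrite /rip ipZl; case: (ip x y) => u v /= ->.
by rewrite mul0r mulN1r opprK add0r => ->.
Qed.

(** Take t = <m, v> / <m, m>, the minimum of the quadratic. This is the orthogonality of the
    residual of a nearest point, in a quantitative form for nearly nearest points. *)
Lemma rip_sqr_le_of_min v m (d e : R) :
  (forall t : R, d <= rip (v - t%:C%C *: m) (v - t%:C%C *: m)) ->
  rip v v <= d + e -> rip m v ^+ 2 <= rip m m * e.
Proof.
move=> dle ve; have [m0|m0] := eqVneq (rip m m) 0.
  by rewrite (rip_eq0 m0) !rip0l mul0r expr0n.
have mp : 0 < rip m m by rewrite lt_def m0 rip_ge0.
have := dle (rip m v / rip m m).
rewrite ripDr !ripDl !ripNr !ripNl !ripZl !ripZr (ripC v m).
move: (rip m m) (rip v v) (rip m v) m0 mp ve => k vv w k0 kp ve.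
have -> : w ^+ 2 = k * (w / k * w) by field.
rewrite ler_pM2l // -[w / k * k]mulrA mulVf // mulr1.
by move: (w / k * w) => z h; lra.
Qed.

(** Projection argument for a subspace that may fail to be closed: a minimizing sequence in [M] is
    Cauchy, and its limit l leaves a residual x - l orthogonal to [M], so l = x. *)
Lemma dense_of_orthogonal0 (M : H -> Prop) :
  M 0 -> (forall x y, M x -> M y -> M (x + y)) ->
  (forall a x, M x -> M (a *: x)) ->
  (forall y, (forall x, M x -> rip x y = 0) -> y = 0) ->
  forall x e, 0 < e -> exists2 m, M m & rnorm (x - m) < e.
Proof.
move=> M0 MD MZ Mo x e e0.
pose E := [set r | exists2 m, M m & r = rip (x - m) (x - m)].
have lbE : lbound E 0 by move=> r [m _ ->]; exact: rip_ge0.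
have infE : has_inf E by split; [exists (rip (x - 0) (x - 0)), 0 | exists 0].
pose d := inf E.
have dle m : M m -> d <= rip (x - m) (x - m).
  by move=> Mm; apply: ge_inf; [exists 0 | exists m].
have /choice[u uP] : forall n : nat, exists m,
    M m /\ rip (x - m) (x - m) <= d + n.+1%:R^-1.
  move=> n; have [|_ [m Mm ->] lt] := inf_adherent (eps := n.+1%:R^-1) _ infE.
    by rewrite invr_gt0.
  by exists m; split; rewrite // ltW.
have inv_small (r : R) : 0 < r ->
    exists n0, forall n, (n0 <= n)%N -> n.+1%:R^-1 <= r.
  move=> r0; have [k] := ltr_add_invr r0; rewrite add0r => kr; exists k => n kn.
  by apply: le_trans (ltW kr); rewrite lef_pV2 ?posrE // ler_nat.
have [|l lP] := ip_complete hH (u := u).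
  move=> c c0; have r0 := ltr0Re c0; set r := complex.Re c in r0.
  (* By the parallelogram law, with the midpoint of u_m and u_n in [M], an excess of at most r^2/8
     over d bounds the squared distance of u_m and u_n by r^2/2. *)
  have [|N NP] := inv_small (r ^+ 2 / 8); first by rewrite divr_gt0 ?exprn_gt0.
  exists N => m n Nm Nn; rewrite hnorm_ltP // -/r.
  have [Mm dm] := uP m; have [Mn dn] := uP n.
  have Mh : M ((2^-1)%:C%C *: (u m + u n)) by exact/MZ/MD.
  have := dle _ Mh; have := NP _ Nm; have := NP _ Nn.
  rewrite -ltr_sqr ?nnegrE ?rnorm_ge0 ?(ltW r0) // sqr_rnorm.
  move: dm dn; rewrite !ripDr !ripDl !ripNr !ripNl !ripZl !ripZr !ripDl !ripDr.
  rewrite !(ripC _ x) (ripC (u n) (u m)).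
  have : 0 < r ^+ 2 by rewrite exprn_gt0.
  move: (r ^+ 2) (m.+1%:R^-1) (n.+1%:R^-1) (rip x x) (rip x (u m)) (rip x (u n)).
  move: (rip (u m) (u m)) (rip (u m) (u n)) (rip (u n) (u n)) (d).
  by move=> *; lra.
have xl : x = l.
  apply/eqP; rewrite -subr_eq0; apply/eqP/Mo => m Mm; apply/normr0_eq0.
  apply/eqP; rewrite eq_le normr_ge0 andbT.
  apply: (@le0_eps _ _ (rnorm m *+ 2)) => r r0.
  have [N NP] := inv_small (r ^+ 2) (exprn_gt0 _ r0).
  have [|N1 N1P] := lP r%:C%C; first by rewrite ltcR.
  pose n := maxn N N1.
  have ln : rnorm (u n - l) < r.
    by have := N1P n (leq_maxr _ _); rewrite hnorm_ltP // ltcR.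
  have [Mn dn] := uP n.
  have rn := NP n (leq_maxl _ _).
  have h : `|rip m (x - u n)| <= rnorm m * r.
    rewrite -ler_sqr ?nnegrE ?mulr_ge0 ?rnorm_ge0 ?(ltW r0) //.
    rewrite real_normK ?num_real // exprMn sqr_rnorm.
    apply: (@rip_sqr_le_of_min _ _ d) => [t|].
      rewrite -addrA -opprD; apply: dle; apply: MD => //; exact: MZ.
    by apply: le_trans dn _; rewrite lerD2l.
  have -> : x - l = (x - u n) + (u n - l) by rewrite addrA subrK.
  rewrite ripDr; apply: le_trans (ler_normD _ _) _.
  rewrite mulrnAl mulr2n; apply: lerD => //.
  by apply: le_trans (ler_rip _ _) _; rewrite ler_wpM2l ?rnorm_ge0 // ltW.
have [|N NP] := lP e%:C%C; first by rewrite ltcR.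
exists (u N); first by have [] := uP N.
have := NP N (leqnn _); rewrite hnorm_ltP ?ltcR //= => ln.
by rewrite -rnormN opprB xl.
Qed.

End RealInnerProduct.

(** * The ring of hermitian elements *)

Section OperatorOrder.
Variables (R : realType) (H : lmodType R[i]) (ip : H -> H -> R[i]).
Variables (D : lmodType R[i]) (j : {linear D -> H}) (A : set (D -> D)).
Hypotheses (hH : is_hilbert ip) (hD : dense_subspace ip j)
  (hA : comm_star_subalg ip j A).
Hypothesis hess : forall a : D -> D, A a -> selfadjoint ip j a ->
  opleq ip j (fun _ => 0) a -> ess_selfadjoint ip j (fun x => x + a x).

Local Notation Ah := (Ah hH hA).
Local Notation le := (@Ah_le R H ip D j hH A hA).
Local Notation rip := (rip ip).
Local Notation nm x := (rnorm ip (j x)).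

(** Elements of [A] are bare functions; linearity is forced by the adjoint, since the defect of
    linearity is orthogonal to every vector of [D], itself included. *)
Lemma adjoint_linear (a b : D -> D) : is_adjoint ip j a b ->
  forall c x y, a (c *: x + y) = c *: a x + a y.
Proof.
move=> ab c x y; apply/eqP; rewrite -subr_eq0; apply/eqP.
set v := _ - _; apply: hD.1; rewrite linear0; apply: (ip_def hH).
have E phi : ip (j phi) (j v) = 0.
  rewrite /v linearB linearD linearZ /= (ipDr hH) (ipNr hH) (ip_linr hH).
  have := (ab phi (c *: x + y), ab phi x, ab phi y); rewrite /ipD => -[[-> ->] ->].
  by rewrite linearD linearZ (ip_linr hH) subrr.
exact: E.
Qed.

Lemma ahval_linear (a : Ah) c x y : ahval a (c *: x + y) = c *: ahval a x + ahval a y.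
Proof. exact: adjoint_linear (ahP a).2 _ _ _. Qed.

Lemma ahvalD (a : Ah) x y : ahval a (x + y) = ahval a x + ahval a y.
Proof. by rewrite -[x]scale1r ahval_linear !scale1r. Qed.

Lemma ahval0 (a : Ah) : ahval a 0 = 0.
Proof. by have /eqP := ahvalD a 0 0; rewrite addr0 -subr_eq subrr eq_sym => /eqP. Qed.

Lemma ahvalZ (a : Ah) c x : ahval a (c *: x) = c *: ahval a x.
Proof. by rewrite -[c *: x]addr0 ahval_linear ahval0 addr0. Qed.

Lemma ahvalB (a : Ah) x y : ahval a (x - y) = ahval a x - ahval a y.
Proof. by rewrite ahvalD -scaleN1r ahvalZ scaleN1r. Qed.

Lemma ahvalN (a : Ah) x : ahval (- a : Ah) x = - ahval a x.
Proof. by []. Qed.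

Lemma rip_ahval (a : Ah) x y : rip (j x) (j (ahval a y)) = rip (j (ahval a x)) (j y).
Proof. by rewrite /rip; congr complex.Re; exact: (ahP a).2. Qed.

Lemma ip_ahval (a : Ah) x :
  ip (j x) (j (ahval a x)) = (rip (j x) (j (ahval a x)))%:C%C.
Proof.
have := (ahP a).2 x x; rewrite /ipD (ip_conj hH (j x)) /rip.
case: (ip (j x) (j (ahval a x))) => u v [/eqP].
by rewrite -addr_eq0 -mulr2n mulrn_eq0 /= => /eqP ->.
Qed.

Lemma Ah_leE (a b : Ah) : le a b <->
  forall x, rip (j x) (j (ahval a x)) <= rip (j x) (j (ahval b x)).
Proof.
by split=> h x; have := h x; rewrite /ipD !ip_ahval lecR.
Qed.

Lemma Ah_posE (a : Ah) : pos le a <-> forall x, 0 <= rip (j x) (j (ahval a x)).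
Proof.
split=> [/Ah_leE h x|h]; last apply/Ah_leE => x.
  by have := h x; rewrite /= linear0 (ripC hH) (rip0l hH).
by rewrite /= linear0 (ripC hH) (rip0l hH).
Qed.

(** Cauchy-Schwarz applied to <x, x> <= <x, x + a x>. *)
Lemma le_norm_ahval (a : Ah) x : pos le a ->
  nm x <= nm (x + ahval a x).
Proof.
move=> /Ah_posE/(_ x) h; have [->|x0] := eqVneq (nm x) 0; first exact: rnorm_ge0.
have xp : 0 < nm x by rewrite lt_def x0 rnorm_ge0.
rewrite -(ler_pM2l xp) -expr2 (sqr_rnorm hH); apply: le_trans (rip_le hH _ _).
by rewrite linearD (ripDr hH) lerDl.
Qed.

(* A vector orthogonal to the range of 1 + a lies in the kernel of the       *)
(* adjoint of 1 + a, hence of its closure, which is bounded below by 1.      *)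
Lemma range_dense (a : Ah) : pos le a ->
  forall x e, 0 < e -> exists d : D, rnorm ip (x - j (d + ahval a d)) < e.
Proof.
move=> pa x e e0; pose M y := exists d : D, y = j (d + ahval a d).
have [||||_ [d ->] lt] := dense_of_orthogonal0 hH (M := M) _ _ _ _ x e0; last by exists d.
- by exists 0; rewrite ahval0 addr0 linear0.
- move=> _ _ [d ->] [d' ->]; exists (d + d').
  by rewrite ahvalD addrACA [in RHS]linearD.
- by move=> c _ [d ->]; exists (c *: d); rewrite ahvalZ -scalerDr linearZ.
move=> y yo.
have yo' d : ip (j (d + ahval a d)) y = 0.
  apply: (ip_eq0 hH); first by apply: yo; exists d.
  by apply: yo; exists ('i%C *: d); rewrite ahvalZ -scalerDr linearZ.
have [Aa sa] := ahP a; have [_ G] := hess Aa sa pa y 0.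
have {G} G : graph_closure ip (op_graph j (fun x => x + ahval a x)) y 0.
  apply: G => u w guw; rewrite (ip0r hH).
  (* w is a limit of range vectors, all orthogonal to y; c = 1 and c = i yield the real and
     imaginary parts of [ip w y]. *)
  have small c : (forall z, rnorm ip (c *: z) = rnorm ip z) -> rip (c *: w) y = 0.
    move=> cN; apply/eqP; rewrite -normr_eq0 eq_le normr_ge0 andbT.
    apply: (@le0_eps _ _ (rnorm ip y)) => r r0.
    have [|_ [_ [[d [-> ->]] _ lt]]] := guw r%:C%C; first by rewrite ltcR.
    have -> : rip (c *: w) y = rip (c *: (w - j (d + ahval a d))) y.
      rewrite scalerBr (ripDl hH) (ripNl hH) {3}/rip (ipZl hH) yo' mulr0.
      by rewrite subr0.
    apply: le_trans (ler_rip hH _ _) _; rewrite cN mulrC.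
    apply: ler_wpM2l; first exact: rnorm_ge0.
    by move: lt; rewrite (hnorm_ltP hH) ?ltcR // => /ltW.
  apply: (ip_eq0 hH); last by apply: small => z; rewrite rnormZi.
  by rewrite -[w]scale1r; apply: small => z; rewrite scale1r.
apply: (rnorm_eq0 hH); apply/eqP; rewrite eq_le rnorm_ge0 andbT.
apply: (@le0_eps _ _ 2) => r r0.
have [|_ [_ [[d [-> ->]]]]] := G r%:C%C; first by rewrite ltcR.
rewrite !(hnorm_ltP hH) ?ltcR //= sub0r (rnormN hH) => l1 l2.
have := le_norm_ahval d pa.
have := ler_rnormD hH (y - j d) (j d); rewrite subrK; lra.
Qed.

(** With s = 1 + a, the hypothesis says that <y, r y> >= 0 for y = s d. To reach an arbitrary x,
    density of the range of s (1 + r^2) = 1 + (a + r s r) makes (1 + r^2)(x - s d) small, and this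
    controls both z = x - s d and r z. *)
Lemma Ah_pos_div (a r : Ah) : pos le a -> pos le ((1 + a) * (1 + a) * r) -> pos le r.
Proof.
move=> pa psr.
(* Approximate x by (1 + a) d in the graph norm of r. *)
have pb : pos le (a + r * (1 + a) * r).
  apply/Ah_posE => x; rewrite /= linearD (ripDr hH) addr_ge0 //.
    by move/Ah_posE: pa; exact.
  rewrite (rip_ahval r) linearD (ripDr hH) addr_ge0 //; first exact: rip_ge0.
  by move/Ah_posE: pa; exact.
have pr : pos le (r * r).
  by apply/Ah_posE => x; rewrite /= (rip_ahval r) rip_ge0.
have normr_le z : nm (ahval r z) <= nm (z + ahval r (ahval r z)).
  rewrite -ler_sqr ?nnegrE ?rnorm_ge0 // !(sqr_rnorm hH) linearD.
  rewrite (ripDr hH) !(ripDl hH) (ripC hH (j (ahval r (ahval r z))) (j z)).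
  rewrite (rip_ahval r z (ahval r z)).
  have := rip_ge0 hH (j z); have := rip_ge0 hH (j (ahval r (ahval r z))).
  have := rip_ge0 hH (j (ahval r z)); lra.
apply/Ah_posE => x; rewrite -oppr_le0.
(* <x, r x> = <s d, r s d> + 2 <z, r x> - <z, r z>: the cross term costs 2 e |r x|, and the last one
   e^2 <= e once e <= 1. *)
apply: (@le0_eps _ _ (nm (ahval r x) *+ 2 + 1)) => e e0.
wlog e1 : e e0 / e <= 1.
  move=> W; have [/W|/ltW e1] := leP e 1; first exact.
  apply: le_trans (W 1 _ _) _; rewrite ?ltr01 // ler_wpM2l //.
  by rewrite addr_ge0 ?mulrn_wge0 ?rnorm_ge0.
have [d] := range_dense pb (j (x + ahval r (ahval r x))) e0.
pose s : Ah := 1 + a; pose z := x - ahval s d.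
have -> : j (x + ahval r (ahval r x)) - j (d + ahval (a + r * (1 + a) * r) d) =
          j (z + ahval r (ahval r z)).
  rewrite -[LHS]linearB; congr (j _); rewrite /z !ahvalB.
  have -> : ahval r (ahval r (ahval s d)) = ahval (r * (1 + a) * r) d.
    have -> : r * (1 + a) * r = r * (r * s) by rewrite mulrAC -mulrA.
    by [].
  have -> : ahval s d = d + ahval a d by [].
  have -> : ahval (a + r * (1 + a) * r : Ah) d =
            ahval a d + ahval (r * (1 + a) * r : Ah) d by [].
  by rewrite addrA opprD addrACA.
move=> lt.
have z_le : nm z <= e by apply: le_trans (ltW lt); exact: (le_norm_ahval z pr).
have rz_le : nm (ahval r z) <= e by apply: le_trans (ltW lt); exact: normr_le.
have xE : x = ahval s d + z by rewrite /z addrC subrK.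
have pd : 0 <= rip (j (ahval s d)) (j (ahval r (ahval s d))).
  rewrite -rip_ahval; move/Ah_posE/(_ d): psr.
  by have -> : s * s * r = s * (r * s) by rewrite -mulrA (mulrC s r).
have : rip (j x) (j (ahval r x)) = rip (j (ahval s d)) (j (ahval r (ahval s d)))
       + rip (j z) (j (ahval r x)) *+ 2 - rip (j z) (j (ahval r z)).
  rewrite xE; move: (ahval s d) (z) => y w.
  rewrite ahvalD !linearD !(ripDl hH) !(ripDr hH).
  rewrite (ripC hH (j y) (j (ahval r w))) -(rip_ahval r w).
  ring.
have b1 := ler_rip hH (j z) (j (ahval r x)).
have b2 := rip_le hH (j z) (j (ahval r z)).
have : nm z * nm (ahval r z) <= e * 1.
  by apply: ler_pM; rewrite ?rnorm_ge0 //; exact: le_trans e1.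
have : nm z * nm (ahval r x) <= e * nm (ahval r x) by rewrite ler_wpM2r ?rnorm_ge0.
move: b1; rewrite ler_norml => /andP[b1 _]; lra.
Qed.

Lemma Ah_archimedean : archimedean le.
Proof.
move=> g h gh; apply/Ah_posE => x; rewrite -oppr_le0.
apply: (@le0_eps _ _ `|rip (j x) (j (ahval h x))|) => e e0.
have [k] := ltr_add_invr e0; rewrite add0r => ke.
have /Ah_posE/(_ x) := gh k.+1 isT.
have -> : ahval (g *+ k.+1 + h) x = k.+1%:R *: ahval g x + ahval h x.
  rewrite scaler_nat [LHS]/=; congr (_ + _).
  by elim: k.+1 => [//|n IH]; rewrite !mulrS /= IH.
have -> : (k.+1%:R : R[i]) = (k.+1%:R : R)%:C%C by rewrite rmorph_nat.
rewrite linearD linearZ (ripDr hH) (ripZr hH).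
set u := rip _ _; set v := rip _ _ => uv.
have k0 : 0 < (k.+1%:R : R) by [].
rewrite -(ler_pM2l k0).
apply: (@le_trans _ _ `|v|); first by have := ler_norm v; lra.
rewrite mulrCA ler_peMr // -(ler_pM2l (x := k.+1%:R^-1)) ?invr_gt0 //.
by rewrite mulr1 mulrA mulVf ?pnatr_eq0 // mul1r ltW.
Qed.

Lemma Ah_po_comring : po_comring le.
Proof.
have sqrP (q p : Ah) : pos le p -> pos le (q * q * p).
  move=> /Ah_posE pp; apply/Ah_posE => x.
  by rewrite -mulrA (mulrC q p) /= rip_ahval.
have P1 : pos le 1 by apply/Ah_posE => x; exact: rip_ge0.
split.
- split; last split.
  + by move=> r; apply/Ah_leE.
  + move=> r s /Ah_leE rs /Ah_leE sr; apply: ah_inj; apply: funext => y.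
    have [c cE] : exists c : Ah, c = s - r by exists (s - r).
    have q0 x : rip (j x) (j (ahval c x)) = 0.
      rewrite cE /= linearD linearN (ripDr hH) (ripNr hH); have := rs x; have := sr x.
      lra.
    have : ahval c y = 0.
      apply: hD.1; rewrite linear0; apply: (rip_eq0 hH).
      (* Polarization: the vanishing form of c at y + c y equals 2 |c y|^2. *)
      have := q0 (y + ahval c y); rewrite ahvalD linearD linearD.
      rewrite !(ripDr hH) !(ripDl hH) !q0 (rip_ahval c y (ahval c y)).
      lra.
    by move/eqP; rewrite cE /= subr_eq0 => /eqP.
  + move=> r s t /Ah_leE rs /Ah_leE st; apply/Ah_leE => x.
    exact: le_trans (rs x) (st x).
- move=> r s t /Ah_leE rs; apply/Ah_leE => x.
  by rewrite /= !linearD !(ripDr hH) lerD2r.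
- move=> r s pr ps; apply: (prod_pos_of_archimedean (P := pos le)) => //.
  + move=> x y /Ah_posE px /Ah_posE py; apply/Ah_posE => z.
    by rewrite /= linearD (ripDr hH) addr_ge0.
  + move=> x /Ah_posE px; apply/Ah_posE => z; have := px z.
    by rewrite /= linearD (ripDr hH); lra.
  + exact: Ah_archimedean.
  + exact: Ah_pos_div.
- by move=> r; rewrite -[_ * _]mulr1; exact: sqrP.
Qed.

(** The witness is s = 1 + r^2. If t s is positive, so is t s^2 by closure under products, and s^2
    cancels; the bounds on r come from the squared norms of x + r x and x - r x. *)
Lemma Ah_localizable : localizable le.
Proof.
move=> r.
have pr : pos le (r * r) by apply/Ah_posE => x; rewrite /= rip_ahval rip_ge0.
have E x : rip (j x) (j (ahval (1 + r * r) x)) =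
           rip (j x) (j x) + rip (j (ahval r x)) (j (ahval r x)).
  by rewrite -rip_ahval -(ripDr hH) -linearD.
exists (1 + r * r); split.
- split=> [|t pt]; first by exists (r * r).
  apply: (Ah_pos_div pr); rewrite mulrC mulrA.
  have [_ _ PM _] := Ah_po_comring.
  apply: PM => //; apply/Ah_posE => x.
  by rewrite E addr_ge0 ?rip_ge0.
- apply/Ah_leE => x; rewrite ahvalN linearN (ripNr hH) E.
  have := rip_ge0 hH (j x + j (ahval r x)).
  have := rip_ge0 hH (j x); have := rip_ge0 hH (j (ahval r x)).
  rewrite !(ripDr hH) !(ripDl hH) (ripC hH (j (ahval r x)) (j x)).
  lra.
- apply/Ah_leE => x; rewrite E.
  have := rip_ge0 hH (j x - j (ahval r x)).
  have := rip_ge0 hH (j x); have := rip_ge0 hH (j (ahval r x)).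
  rewrite !(ripDr hH) !(ripDl hH) !(ripNr hH) !(ripNl hH).
  rewrite (ripC hH (j (ahval r x)) (j x)).
  lra.
Qed.

End OperatorOrder.

(** * Characters of archimedean rings *)

Lemma le0_natmul (R : archiRealFieldType) (x c : R) :
  (forall n, (0 < n)%N -> x *+ n <= c) -> x <= 0.
Proof.
move=> h; rewrite leNgt; apply/negP => x0.
have := archi_boundP (normr_ge0 (c / x)); set n := Num.bound _ => lt.
have := h n.+1 isT; rewrite leNgt => /negP; apply.
rewrite -mulr_natr mulrC -ltr_pdivrMr //.
apply: le_lt_trans (ler_norm _) _; apply: lt_trans lt _.
by rewrite ltr_nat.
Qed.

Section KadisonDubois.
Variables (L : comPzRingType) (P : L -> Prop) (RR : realType).
Hypotheses (PD : forall x y, P x -> P y -> P (x + y))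
  (PM : forall x y, P x -> P y -> P (x * y))
  (Psq : forall x, P (x * x))
  (Parch : forall g h, (forall k, (0 < k)%N -> P (g *+ k + h)) -> P g).

(** * Order-bounded elements *)

Definition bounded (x : L) := exists n : nat, P (n%:R + x) /\ P (n%:R - x).

Let P0 : P 0. Proof. by rewrite -(mul0r 0); exact: Psq. Qed.
Let P1 : P 1. Proof. by rewrite -(mul1r 1); exact: Psq. Qed.
Let Pmuln x n : P x -> P (x *+ n).
Proof. by move=> Px; elim: n => [|n IH]; rewrite ?mulr0n // mulrSr; exact: PD. Qed.
Let Pnat n : P n%:R. Proof. exact: Pmuln. Qed.

Lemma bounded_nat n : bounded n%:R.
Proof. by exists n; rewrite subrr; split; rewrite // -natrD; exact: Pnat. Qed.

Lemma bounded0 : bounded 0. Proof. exact: (bounded_nat 0). Qed.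
Lemma bounded1 : bounded 1. Proof. exact: (bounded_nat 1). Qed.

Lemma boundedN x : bounded x -> bounded (- x).
Proof. by case=> n [h1 h2]; exists n; rewrite opprK. Qed.

Lemma boundedD x y : bounded x -> bounded y -> bounded (x + y).
Proof.
case=> n [h1 h2] [m [h3 h4]]; exists (n + m)%N; rewrite natrD opprD.
by split; rewrite addrACA; exact: PD.
Qed.

Lemma boundedB x y : bounded x -> bounded y -> bounded (x - y).
Proof. by move=> bx /boundedN; exact: boundedD. Qed.

Lemma boundedM x y : bounded x -> bounded y -> bounded (x * y).
Proof.
case=> n [h1 h2] [m [h3 h4]]; exists (3 * (n * m))%N; split.
  have -> : (3 * (n * m))%:R + x * y =
    (n%:R + x) * (m%:R + y) + (m%:R - y) *+ n + (n%:R - x) *+ m :> L by ring.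
  by apply: PD; [apply: PD; [exact: PM | exact: Pmuln] | exact: Pmuln].
have -> : (3 * (n * m))%:R - x * y =
  (n%:R - x) * (m%:R + y) + (m%:R - y) *+ n + (n%:R + x) *+ m :> L by ring.
by apply: PD; [apply: PD; [exact: PM | exact: Pmuln] | exact: Pmuln].
Qed.

Lemma bounded_muln x n : bounded x -> bounded (x *+ n).
Proof. by move=> bx; rewrite -mulr_natr; apply: boundedM => //; exact: bounded_nat. Qed.

Lemma bounded_mulz x (m : int) : bounded x -> bounded (x *~ m).
Proof.
by case: m => n bx; rewrite ?NegzE ?mulrNz; [|apply: boundedN]; exact: bounded_muln.
Qed.

(** Replaces division by n, as [L] need not contain the rationals: in k x the full multiples of n x
    are positive, and the remainder, fewer than n copies of x, is absorbed by the constant n K. *)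
Lemma pos_of_natmul x n : bounded x -> (0 < n)%N -> P (x *+ n) -> P x.
Proof.
move=> [K [h1 h2]] n0 xn; apply: (Parch (h := (n * K)%:R)) => k _.
have -> : x *+ k + (n * K)%:R = x *+ n *+ (k %/ n) + (K%:R + x) *+ (k %% n)
          + (K * (n - k %% n))%:R.
  rewrite {1}(divn_eq k n) mulrnDr mulrnAC mulrnA mulrnDl -!addrA; congr (_ + _).
  rewrite addrCA; congr (_ + _); rewrite -mulrnA -natrD -mulnDr.
  by rewrite subnKC 1?mulnC // ltnW // ltn_mod.
by apply: PD => //; apply: PD; exact: Pmuln.
Qed.

(* From b q = 1 + p with q <= N one gets N (N b + m - 1) >= 0 out of         *)
(* N b + m >= 0, hence N b >= 0 by descent on m.                             *)
Lemma pos_of_mul_ge1 b p q : bounded b -> bounded q ->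
  P p -> P q -> b * q = 1 + p -> P b.
Proof.
move=> bb [N0 [_ hq]] Pp Pq bq; pose N := N0.+1.
have {}hq : P (N%:R - q) by rewrite mulrS -addrA; exact: PD.
have bNb : bounded (b *+ N) by exact: bounded_muln.
have [M [hM _]] := bNb.
apply: (@pos_of_natmul _ N) => //.
elim: M hM => [|m IH h]; first by rewrite add0r.
apply: IH; apply: (@pos_of_natmul _ N) => //.
  by apply: boundedD => //; exact: bounded_nat.
have -> : (m%:R + b *+ N) *+ N =
  (N%:R - q) * (m.+1%:R + b *+ N) + p *+ N + q *+ m.+1.
  have -> : (N%:R - q) * (m.+1%:R + b *+ N) =
    (m.+1%:R + b *+ N) *+ N - q *+ m.+1 - (b * q) *+ N by ring.
  by rewrite bq; ring.
by apply: PD; [apply: PD; [exact: PM | exact: Pmuln] | exact: Pmuln].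
Qed.

(** * Cones of bounded elements and their maximal extensions *)

Definition cone (T : set L) := [/\ (forall x, T x -> bounded x),
  (forall x, P x -> bounded x -> T x), (forall x y, T x -> T y -> T (x + y)),
  (forall x y, T x -> T y -> T (x * y)) & ~ T (-1)].

Definition adjoin (T : set L) (x : L) : set L :=
  [set z | exists t u, [/\ T t, T u & z = t + x * u]].

Lemma adjoin_cone (T : set L) x :
  (forall y, T y -> bounded y) -> (forall y, P y -> bounded y -> T y) ->
  (forall y z, T y -> T z -> T (y + z)) -> (forall y z, T y -> T z -> T (y * z)) ->
  bounded x -> ~ adjoin T x (-1) -> cone (adjoin T x).
Proof.
move=> Tb PT TD TM bx n1; have T0 : T 0 by apply: PT => //; exact: bounded0.
split=> //.
- move=> _ [t [u [Tt Tu ->]]]; apply: boundedD; first exact: Tb.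
  by apply: boundedM => //; exact: Tb.
- by move=> y Py bdy; exists y, 0; rewrite mulr0 addr0; split=> //; exact: PT.
- move=> _ _ [t [u [Tt Tu ->]]] [t' [u' [Tt' Tu' ->]]].
  by exists (t + t'), (u + u'); rewrite mulrDr addrACA; split=> //; exact: TD.
- move=> _ _ [t [u [Tt Tu ->]]] [t' [u' [Tt' Tu' ->]]].
  (* The square x * x is bounded and positive, hence in [T], so the product is again of degree one
     in x. *)
  exists (t * t' + x * x * (u * u')), (t * u' + t' * u); split.
  + apply: (TD); apply: (TM) => //; last exact: TM.
    by apply: PT => //; exact: boundedM.
  + by apply: (TD); exact: TM.
  + by ring.
Qed.

Lemma exists_maximal_cone T0 : cone T0 ->
  exists2 T, cone T /\ T0 `<=` T & forall S, cone S -> T `<=` S -> S `<=` T.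
Proof.
move=> cT0; pose X := {T : set L | cone T /\ T0 `<=` T}.
pose t0 : X := exist _ T0 (conj cT0 (@subset_refl _ T0)).
pose le (S T : X) : bool := `[< sval S `<=` sval T >].
have [||A totA|T maxT] := @ZL_preorder X t0 le.
- by move=> S; apply/asboolP.
- by move=> S T U /asboolP h1 /asboolP h2; apply/asboolP; exact: subset_trans h2.
- have [[S0 AS0]|nA] := pselect (exists S, A S); last first.
    by exists t0 => S AS; case: nA; exists S.
  pose U := [set x | exists2 S : X, A S & sval S x].
  have two x y : U x -> U y -> exists S : X, [/\ A S, sval S x & sval S y].
    move=> [S AS Sx] [S' AS' Sy]; have [/asboolP SS|/asboolP SS] := totA _ _ AS AS'.
      by exists S'; split=> //; exact: SS.
    by exists S; split=> //; exact: SS.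
  have cU : cone U /\ T0 `<=` U.
    split; last by move=> x T0x; exists S0 => //; exact: (svalP S0).2.
    split.
    + by move=> x [S _]; have [[h _ _ _ _] _] := svalP S; exact: h.
    + by move=> x Px bx; exists S0 => //; have [[_ h _ _ _] _] := svalP S0; exact: h.
    + move=> x y Ux Uy; have [S [AS Sx Sy]] := two _ _ Ux Uy; exists S => //.
      by have [[_ _ h _ _] _] := svalP S; exact: h.
    + move=> x y Ux Uy; have [S [AS Sx Sy]] := two _ _ Ux Uy; exists S => //.
      by have [[_ _ _ h _] _] := svalP S; exact: h.
    + by move=> [S _]; have [[_ _ _ _ h] _] := svalP S.
  by exists (exist _ U cU) => S AS; apply/asboolP => x Sx; exists S.
exists (sval T); first exact: (svalP T).
move=> S cS TS; have T0S : T0 `<=` S by apply: subset_trans TS; exact: (svalP T).2.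
by have /asboolP := maxT (exist _ S (conj cS T0S)) (asboolT TS).
Qed.

(** If neither x nor -x can be adjoined, then -1 = t + x u = t' - x u'. Multiplying x u = -(1 + t)
    by x u' = 1 + t' expresses -1 as t + t' + t t' + x^2 u u', an element of [T]. *)
Lemma maximal_cone_total T : cone T ->
  (forall S, cone S -> T `<=` S -> S `<=` T) ->
  forall x, bounded x -> T x \/ T (- x).
Proof.
move=> [Tb PT TD TM T1] maxT x bx.
have T0 : T 0 by apply: PT => //; exact: bounded0.
have Tone : T 1 by apply: PT => //; exact: bounded1.
have sub y : T `<=` adjoin T y.
  by move=> t Tt; exists t, 0; rewrite mulr0 addr0.
have in_adj y : adjoin T y y by exists 0, 1; rewrite mulr1 add0r.
have [[t [u [Tt Tu e]]]|n1] := pselect (adjoin T x (-1)); last first.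
  by left; apply: (maxT _ _ (sub x)) => //; exact: adjoin_cone.
have [[t' [u' [Tt' Tu' e']]]|n1] := pselect (adjoin T (- x) (-1)); last first.
  right; apply: (maxT _ _ (sub (- x))) => //.
  by apply: adjoin_cone => //; exact: boundedN.
case: T1; have -> : -1 = t + t' + t * t' + x * x * (u * u').
  have xu : x * u = -1 - t by rewrite e addrAC subrr add0r.
  have xu' : x * u' = 1 + t'.
    apply: oppr_inj; rewrite -mulNr opprD e' [in X in _ = X]addrAC subrr add0r //.
  rewrite mulrACA xu xu'; ring.
apply: (TD); first by apply: (TD); [exact: TD | exact: TM].
apply: (TM); last exact: TM.
by apply: PT => //; exact: boundedM.
Qed.

(** * The character of a total cone *)

Section CharacterOfCone.
Variable T : set L.
Hypotheses (cT : cone T) (totT : forall x, bounded x -> T x \/ T (- x)).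

Let TD x y : T x -> T y -> T (x + y). Proof. by case: cT => _ _ h _ _; exact: h. Qed.
Let TM x y : T x -> T y -> T (x * y). Proof. by case: cT => _ _ _ h _; exact: h. Qed.
Let PT x : P x -> bounded x -> T x. Proof. by case: cT => _ h _ _ _; exact: h. Qed.
Let Tn1 : ~ T (-1). Proof. by case: cT. Qed.
Let Tnat n : T n%:R. Proof. by apply: PT => //; exact: bounded_nat. Qed.
Let Tmuln x n : T x -> T (x *+ n).
Proof.
move=> Tx; elim: n => [|n IH]; first by rewrite mulr0n; exact: (Tnat 0).
by rewrite mulrSr; exact: TD.
Qed.
Let Tint (m : int) : T m%:~R -> 0 <= m.
Proof.
case: m => // n; rewrite NegzE mulrNz => h; case: Tn1.
have -> : -1 = - (Posz n.+1)%:~R + n%:R :> L by rewrite -pmulrn mulrSr; ring.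
by apply: TD.
Qed.

(** The Dedekind cut of x for the preorder given by [T]: m/n lies below x when n x - m is in [T],
    stated with integers to avoid division in [L]. *)
Definition cone_char (x : L) : RR :=
  sup [set r | exists (n : nat) (m : int),
         [/\ (0 < n)%N, T (x *+ n - m%:~R) & r = m%:~R / n%:R]].

Let rational_le x n n' (m m' : int) :
  T (x *+ n - m%:~R) -> T (m'%:~R - x *+ n') -> m *+ n' <= m' *+ n.
Proof.
move=> h h'; rewrite -subr_ge0; apply: Tint.
have -> : (m' *+ n - m *+ n')%:~R =
    (x *+ n - m%:~R) *+ n' + (m'%:~R - x *+ n') *+ n :> L.
  by rewrite rmorphB !rmorphMn /=; ring.
by apply: TD; exact: Tmuln.
Qed.

Let ub_char x n' (m' : int) : (0 < n')%N -> T (m'%:~R - x *+ n') ->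
  ubound [set r : RR | exists (n : nat) (m : int),
         [/\ (0 < n)%N, T (x *+ n - m%:~R) & r = m%:~R / n%:R]] (m'%:~R / n'%:R).
Proof.
move=> n0' h' _ [n [m [n0 h ->]]].
rewrite ler_pdivrMr ?ltr0n // mulrAC ler_pdivlMr ?ltr0n //.
by rewrite !mulr_natr -!rmorphMn /= ler_int; exact: rational_le h h'.
Qed.

Lemma cone_char_ge x n (m : int) : bounded x -> (0 < n)%N ->
  T (x *+ n - m%:~R) -> m%:~R <= cone_char x *+ n.
Proof.
move=> bx n0 h; rewrite -mulr_natr -ler_pdivrMr ?ltr0n //.
apply: ub_le_sup; last by exists n, m.
have [N [_ hN]] := bx; exists (N%:~R / 1%:R); apply: ub_char => //.
by apply: PT; rewrite ?mulr1n // -pmulrn //; apply: boundedB => //; exact: bounded_nat.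
Qed.

Lemma cone_char_le x n (m : int) : bounded x -> (0 < n)%N ->
  T (m%:~R - x *+ n) -> cone_char x *+ n <= m%:~R.
Proof.
move=> bx n0 h; rewrite -mulr_natr -ler_pdivlMr ?ltr0n //.
apply: ge_sup; last exact: ub_char.
have [N [hN _]] := bx; exists ((- N%:~R) / 1%:R), 1%N, (- N%:Z); split=> //.
  apply: PT; rewrite mulr1n mulrNz opprK addrC -pmulrn //.
  by apply: boundedD => //; exact: bounded_nat.
by rewrite mulrNz.
Qed.

(** Integer part of x for the preorder of [T]: stop at the first integer whose difference from x
    leaves [T]; totality then bounds x from above. *)
Lemma cone_floor x : bounded x ->
  exists m : int, T (x - m%:~R) /\ T ((m + 1)%:~R - x).
Proof.
move=> bx; have [N [hN hN']] := bx.
pose Q n := ~~ `[< T (x + N%:R - n%:R) >].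
have exQ : exists n, Q n.
  exists (N + N).+1; apply/asboolPn => h; apply: Tn1.
  have -> : -1 = x + N%:R - (N + N).+1%:R + (N%:R - x) by rewrite mulrS natrD; ring.
  apply: TD => //; apply: PT => //.
  by apply: boundedB => //; exact: bounded_nat.
have TN : T (x + N%:R).
  by rewrite addrC; apply: PT => //; apply: boundedD => //; exact: bounded_nat.
case: (ex_minnP exQ) => -[|n] /asboolPn nT minn.
  by case: nT; rewrite mulr0n subr0.
exists (n%:Z - N%:Z); split.
  have : ~~ Q n by apply/negP => /minn; rewrite ltnn.
  rewrite negbK => /asboolP.
  by rewrite mulrzBr -!pmulrn opprB addrA.
have bz : bounded (x + N%:R - n.+1%:R).
  by apply: boundedB; [apply: boundedD|]; rewrite //; exact: bounded_nat.
have [//|] := totT bz.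
rewrite mulrzDr mulrzBr -!pmulrn mulrS.
by have -> : - (x + N%:R - (1 + n%:R)) = n%:R - N%:R + 1 - x by ring.
Qed.

Lemma cone_char_floor x n : bounded x -> (0 < n)%N ->
  exists m : int, [/\ T (x *+ n - m%:~R), T ((m + 1)%:~R - x *+ n),
    m%:~R <= cone_char x *+ n & cone_char x *+ n <= m%:~R + 1].
Proof.
move=> bx n0; have [m [h1 h2]] := cone_floor (bounded_muln n bx).
exists m; split=> //; first exact: cone_char_ge.
by have := cone_char_le bx n0 h2; rewrite rmorphD.
Qed.

Lemma cone_char_pos x : T x -> 0 <= cone_char x.
Proof.
move=> Tx; have bx : bounded x by case: cT => h _ _ _ _; exact: h.
have := @cone_char_ge x 1 0 bx isT; rewrite mulr1n; apply.
by rewrite subr0.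
Qed.

Lemma cone_char1 : cone_char 1 = 1.
Proof.
apply/eqP; rewrite eq_le; apply/andP; split.
  have := @cone_char_le 1 1 1 bounded1 isT; rewrite mulr1n; apply.
  by rewrite subrr; exact: (Tnat 0).
have := @cone_char_ge 1 1 1 bounded1 isT; rewrite mulr1n; apply.
by rewrite subrr; exact: (Tnat 0).
Qed.

(** Adding integer parts of n x and n y locates n (x + y) up to 2, so n times the defect of
    additivity stays at most 2 for all n. *)
Lemma cone_charD x y : bounded x -> bounded y ->
  cone_char (x + y) = cone_char x + cone_char y.
Proof.
move=> bx bdy; have bxy := boundedD bx bdy.
have key n : (0 < n)%N ->
    `|cone_char (x + y) - (cone_char x + cone_char y)| *+ n <= 2.
  move=> n0; have [m [h1 h2 h3 h4]] := cone_char_floor bx n0.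
  have [m' [h1' h2' h3' h4']] := cone_char_floor bdy n0.
  have := @cone_char_ge (x + y) n (m + m') bxy n0.
  rewrite mulrnDl rmorphD /= opprD addrACA => /(_ (TD h1 h1')) g1.
  have := @cone_char_le (x + y) n (m + 1 + (m' + 1)) bxy n0.
  rewrite rmorphD [(x + y) *+ n]mulrnDl opprD addrACA => /(_ (TD h2 h2')).
  rewrite !rmorphD /= => g2.
  rewrite -normrMn ler_norml.
  rewrite mulrnBl mulrnDl rmorphD /= in g1 *; rewrite rmorph1 in g2.
  move: (cone_char (x + y) *+ n) (cone_char x *+ n) (cone_char y *+ n) g1 g2 h3 h4 h3' h4'.
  move: (m%:~R) (m'%:~R) => *; lra.
apply/eqP; rewrite -subr_eq0 -normr_eq0 eq_le normr_ge0 andbT.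
exact: le0_natmul key.
Qed.

Lemma cone_char0 : cone_char 0 = 0.
Proof. by have := cone_charD bounded0 bounded0; rewrite addr0; lra. Qed.

Lemma cone_charN x : bounded x -> cone_char (- x) = - cone_char x.
Proof.
move=> bx; have := cone_charD bx (boundedN bx); rewrite subrr cone_char0; lra.
Qed.

Lemma cone_charB x y : bounded x -> bounded y ->
  cone_char (x - y) = cone_char x - cone_char y.
Proof.
move=> bx bdy; rewrite cone_charD ?cone_charN //; exact: boundedN.
Qed.

Lemma cone_charMn x n : bounded x -> cone_char (x *+ n) = cone_char x *+ n.
Proof.
move=> bx; elim: n => [|n IH]; first by rewrite !mulr0n cone_char0.
by rewrite !mulrS cone_charD ?IH //; exact: bounded_muln.
Qed.

Lemma cone_charMz x m : bounded x -> cone_char (x *~ m) = cone_char x *~ m.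
Proof.
case: m => n bx; first exact: cone_charMn.
by rewrite NegzE !mulrNz cone_charN ?cone_charMn //; exact: bounded_muln.
Qed.

(** For y in [T], m <= n x <= m + 1 may be multiplied by y, so n times the defect of
    multiplicativity is at most the value at y. *)
Let cone_charM_pos x y : bounded x -> T y ->
  cone_char (x * y) = cone_char x * cone_char y.
Proof.
move=> bx Ty; have bdy : bounded y by case: cT => h _ _ _ _; exact: h.
have bxy := boundedM bx bdy; have y0 := cone_char_pos Ty.
apply/eqP; rewrite -subr_eq0 -normr_eq0 eq_le normr_ge0 andbT.
apply: (@le0_natmul _ _ (cone_char y)) => n n0.
have [m [h1 h2 h3 h4]] := cone_char_floor bx n0.
have := cone_char_pos (TM h1 Ty); have := cone_char_pos (TM h2 Ty).
have -> : (x *+ n - m%:~R) * y = x * y *+ n - y *~ m.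
  by rewrite mulrBl mulrnAl mulrzl.
have -> : ((m + 1)%:~R - x *+ n) * y = y - (x * y *+ n - y *~ m).
  by rewrite rmorphD /= mulrBl mulrDl mul1r mulrnAl mulrzl opprB addrA (addrC y).
have b1 := bounded_muln n bxy; have b2 := bounded_mulz m bdy.
rewrite [cone_char (y - _)]cone_charB //; last exact: boundedB.
rewrite !cone_charB // !cone_charMn // !cone_charMz //.
rewrite -normrMn ler_norml mulrnBl.
rewrite -[cone_char y *~ m]mulrzr -[cone_char x * _ *+ n]mulrnAl.
move: (cone_char (x * y) *+ n) (cone_char x *+ n) (m%:~R) h3 h4 => u v w.
move: (cone_char y) y0 => t t0 h3 h4 g1 g2; nra.
Qed.

Lemma cone_charM x y : bounded x -> bounded y ->
  cone_char (x * y) = cone_char x * cone_char y.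
Proof.
move=> bx bdy; have [Ty|Ty] := totT bdy; first exact: cone_charM_pos.
have := cone_charM_pos bx Ty; rewrite mulrN !cone_charN ?mulrN //.
  by move/oppr_inj.
exact: boundedM.
Qed.

End CharacterOfCone.

(** By the archimedean property some c = k b + 1 is still not positive; the shift by 1 makes the
    final inequality strict. Adjoining -c is consistent: -1 = p - c q would give c q = 1 + p, and
    [pos_of_mul_ge1] would make c positive. *)
Lemma exists_negative_character b : bounded b -> ~ P b ->
  exists phi : L -> RR,
  [/\ (forall x y, bounded x -> bounded y -> phi (x + y) = phi x + phi y),
      (forall x y, bounded x -> bounded y -> phi (x * y) = phi x * phi y),
      phi 1 = 1, (forall x, P x -> bounded x -> 0 <= phi x) & phi b < 0].
Proof.
move=> bb nPb.
have [k [k0 nPc]] : exists k, (0 < k)%N /\ ~ P (b *+ k + 1).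
  apply: contrapT => h; apply: nPb; apply: (Parch (h := 1)) => k k0.
  by apply: contrapT => nP; apply: h; exists k.
set c := b *+ k + 1 in nPc.
have bc : bounded c by apply: boundedD bounded1; exact: bounded_muln.
have cT0 : cone (adjoin [set x | P x /\ bounded x] (- c)).
  apply: adjoin_cone.
  - by move=> y [].
  - by [].
  - by move=> y z [Py bdy] [Pz bz]; split; [exact: PD | exact: boundedD].
  - by move=> y z [Py bdy] [Pz bz]; split; [exact: PM | exact: boundedM].
  - exact: boundedN.
  move=> [p [q [[Pp bp] [Pq bq] e]]]; apply: nPc.
  apply: (pos_of_mul_ge1 bc bq Pp Pq).
  by apply/eqP; rewrite -subr_eq0 -[1 + p]opprK opprD e mulNr; apply/eqP; ring.
have [T [cT sT] maxT] := exists_maximal_cone cT0.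
have totT := maximal_cone_total cT maxT.
exists (cone_char T); split.
- exact: cone_charD.
- exact: cone_charM.
- exact: cone_char1.
- by move=> x Px bx; apply: cone_char_pos => //; case: cT => _ h _ _ _; exact: h.
have Tc : T (- c).
  apply: sT; exists 0, 1; rewrite mulr1 add0r.
  by split=> //; split=> //; [exact: bounded0 | exact: bounded1].
have := cone_char_pos cT Tc; rewrite cone_charN // cone_charD //; last exact: bounded1.
  rewrite cone_char1 // cone_charMn // => h.
  by rewrite -(pmulrn_llt0 _ k0); lra.
exact: bounded_muln.
Qed.

End KadisonDubois.

(** * Localization *)

(** Links raw pairs, in which characters are expressed, to a genuine ring of fractions, to which the
    results on archimedean rings apply. Only pairs with denominator in [S] are constrained, apart
    from the unit. *)
Definition is_localization (R : comPzRingType) (S : R -> Prop)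
    (L : comPzRingType) (q : R * R -> L) : Prop :=
  [/\ (forall z, exists2 x, S x.2 & q x = z),
      (forall x y, S x.2 -> S y.2 -> (q x = q y <-> x.1 * y.2 = y.1 * x.2)),
      (forall x y, S x.2 -> S y.2 ->
        q (x.1 * y.2 + y.1 * x.2, x.2 * y.2) = q x + q y),
      (forall x y, S x.2 -> S y.2 -> q (x.1 * y.1, x.2 * y.2) = q x * q y) &
      q (1, 1) = 1].

Section Localization.
Variables (R : comPzRingType) (S : R -> Prop).
Hypotheses (S1 : S 1) (SM : forall s t, S s -> S t -> S (s * t))
  (Sreg : forall r s, S s -> r * s = 0 -> r = 0).

Local Open Scope quotient_scope.

Record fraction := Fraction { fnum : R; fden : R; fdenP : S fden }.
HB.instance Definition _ := gen_eqMixin fraction.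
HB.instance Definition _ := gen_choiceMixin fraction.

Definition frac_rel (x y : fraction) : bool :=
  `[< fnum x * fden y = fnum y * fden x >].

Lemma frac_rel_refl : reflexive frac_rel.
Proof. by move=> x; apply/asboolP. Qed.

Lemma frac_rel_sym : symmetric frac_rel.
Proof. by move=> x y; apply/asboolP/asboolP. Qed.

Lemma frac_rel_trans : transitive frac_rel.
Proof.
move=> y x z /asboolP xy /asboolP yz; apply/asboolP/eqP; rewrite -subr_eq0.
apply/eqP/(Sreg (fdenP y)).
have -> : (fnum x * fden z - fnum z * fden x) * fden y =
  fnum x * fden y * fden z - fnum z * fden y * fden x by ring.
by rewrite xy -yz; ring.
Qed.

Canonical frac_equiv := EquivRel frac_rel frac_rel_refl frac_rel_sym frac_rel_trans.

Definition loc := {eq_quot frac_rel}.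
HB.instance Definition _ : EqQuotient _ frac_rel loc := EqQuotient.on loc.
HB.instance Definition _ := Choice.on loc.

Lemma pi_locP (x y : fraction) :
  \pi_loc x = \pi_loc y <-> fnum x * fden y = fnum y * fden x.
Proof. by split=> [/eqmodP/asboolP|h]; last apply/eqmodP/asboolP. Qed.

Lemma repr_pi_loc x :
  fnum (repr (\pi_loc x)) * fden x = fnum x * fden (repr (\pi_loc x)).
Proof. by apply/pi_locP; rewrite reprK. Qed.

Definition loc_add (a b : loc) : loc := \pi_loc
  (@Fraction (fnum (repr a) * fden (repr b) + fnum (repr b) * fden (repr a)) _
     (SM (fdenP (repr a)) (fdenP (repr b)))).
Definition loc_mul (a b : loc) : loc := \pi_loc
  (@Fraction (fnum (repr a) * fnum (repr b)) _ (SM (fdenP (repr a)) (fdenP (repr b)))).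
Definition loc_opp (a : loc) : loc :=
  \pi_loc (@Fraction (- fnum (repr a)) _ (fdenP (repr a))).
Definition loc_of (r : R) : loc := \pi_loc (@Fraction r _ S1).

Lemma loc_addE x y : loc_add (\pi_loc x) (\pi_loc y) =
  \pi_loc (@Fraction (fnum x * fden y + fnum y * fden x) _ (SM (fdenP x) (fdenP y))).
Proof.
apply/pi_locP => /=; have := (repr_pi_loc x, repr_pi_loc y).
case: (repr _) => n d Sd; case: (repr _) => n' d' Sd'; case: x y => [a b Sb] [a' b' Sb'] /=.
move=> [e e'].
have -> : (n * d' + n' * d) * (b * b') = (n * b) * (d' * b') + (n' * b') * (d * b) by ring.
by rewrite e e'; ring.
Qed.

Lemma loc_mulE x y : loc_mul (\pi_loc x) (\pi_loc y) =
  \pi_loc (@Fraction (fnum x * fnum y) _ (SM (fdenP x) (fdenP y))).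
Proof.
apply/pi_locP => /=; have := (repr_pi_loc x, repr_pi_loc y).
case: (repr _) => n d Sd; case: (repr _) => n' d' Sd'; case: x y => [a b Sb] [a' b' Sb'] /=.
by move=> [e e']; rewrite mulrACA e e'; ring.
Qed.

Lemma loc_oppE x : loc_opp (\pi_loc x) = \pi_loc (@Fraction (- fnum x) _ (fdenP x)).
Proof. by apply/pi_locP => /=; rewrite mulNr repr_pi_loc mulNr. Qed.

Lemma loc_addA : associative loc_add.
Proof.
elim/quotW=> x; elim/quotW=> y; elim/quotW=> z.
rewrite (loc_addE y z) (loc_addE x y) (loc_addE x) (loc_addE _ z).
by apply/pi_locP => /=; ring.
Qed.

Lemma loc_addC : commutative loc_add.
Proof.
by elim/quotW=> x; elim/quotW=> y; rewrite (loc_addE x y) (loc_addE y x); apply/pi_locP => /=; ring.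
Qed.

Lemma loc_add0 : left_id (loc_of 0) loc_add.
Proof. by elim/quotW=> x; rewrite loc_addE; apply/pi_locP => /=; ring. Qed.

Lemma loc_addN : left_inverse (loc_of 0) loc_opp loc_add.
Proof. by elim/quotW=> x; rewrite loc_oppE loc_addE; apply/pi_locP => /=; ring. Qed.

HB.instance Definition _ :=
  GRing.isZmodule.Build loc loc_addA loc_addC loc_add0 loc_addN.

Lemma loc_mulA : associative loc_mul.
Proof.
elim/quotW=> x; elim/quotW=> y; elim/quotW=> z.
rewrite (loc_mulE y z) (loc_mulE x y) (loc_mulE x) (loc_mulE _ z).
by apply/pi_locP => /=; ring.
Qed.

Lemma loc_mulC : commutative loc_mul.
Proof.
by elim/quotW=> x; elim/quotW=> y; rewrite (loc_mulE x y) (loc_mulE y x); apply/pi_locP => /=; ring.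
Qed.

Lemma loc_mul1 : left_id (loc_of 1) loc_mul.
Proof. by elim/quotW=> x; rewrite loc_mulE; apply/pi_locP => /=; ring. Qed.

Lemma loc_mulDl : left_distributive loc_mul loc_add.
Proof.
elim/quotW=> x; elim/quotW=> y; elim/quotW=> z.
rewrite (loc_addE x y) (loc_mulE _ z) (loc_mulE x z) (loc_mulE y z) loc_addE.
by apply/pi_locP => /=; ring.
Qed.

HB.instance Definition _ :=
  GRing.Zmodule_isComPzRing.Build loc loc_mulA loc_mulC loc_mul1 loc_mulDl.

Lemma localization_exists :
  exists (L : comPzRingType) (q : R * R -> L), is_localization S q.
Proof.
(* Pairs with a denominator outside [S] get the default value 0. *)
pose q (x : R * R) : loc :=
  if pselect (S x.2) is left Sx then \pi_loc (@Fraction x.1 _ Sx) else 0.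
have qE x (Sx : S x.2) : q x = \pi_loc (@Fraction x.1 _ Sx).
  by rewrite /q; case: pselect => // Sx'; apply/pi_locP.
exists loc, q; split.
- by elim/quotW=> -[a b Sb]; exists (a, b) => //; rewrite (qE (a, b) Sb).
- by move=> x y Sx Sy; rewrite !qE; exact: pi_locP.
- move=> x y Sx Sy; rewrite (qE x Sx) (qE y Sy) [RHS]loc_addE.
  by rewrite (qE (_, _) (SM Sx Sy)).
- move=> x y Sx Sy; rewrite (qE x Sx) (qE y Sy) [RHS]loc_mulE.
  by rewrite (qE (_, _) (SM Sx Sy)).
- by rewrite (qE (_, _) S1).
Qed.

End Localization.

(** * The extended Gelfand transformation *)

Section Gelfand.
Variables (Rg : comPzRingType) (le : Rg -> Rg -> Prop) (RR : realType).
Hypotheses (po : po_comring le) (arch : archimedean le).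
Local Notation pos := (pos le).
Local Notation Loc := (Loc le).
Local Notation bdloc := (bdloc le).
Local Notation KR := (@KR Rg le RR).
Local Notation Kopen := (@Kopen Rg le RR).
Local Notation frac := (Defs.frac Rg).

Lemma le_pos x y : le x y <-> pos (y - x).
Proof.
have [_ leD _ _] := po; split=> h.
  by have := leD _ _ (- x) h; rewrite subrr.
by have := leD _ _ x h; rewrite add0r subrK.
Qed.

Lemma posD x y : pos x -> pos y -> pos (x + y).
Proof.
move=> px /le_pos; rewrite subr0 => py; have [[_ [_ tr]] leD _ _] := po.
by apply: (tr _ y) => //; have := leD _ _ y px; rewrite add0r.
Qed.

Lemma posM x y : pos x -> pos y -> pos (x * y).
Proof. by have [_ _ h _] := po; exact: h. Qed.

Lemma pos_sqr x : pos (x * x).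
Proof. by have [_ _ _ h] := po; exact: h. Qed.

Lemma pos1 : pos 1. Proof. by rewrite -(mulr1 1); exact: pos_sqr. Qed.

Lemma pos_antisym x : pos x -> pos (- x) -> x = 0.
Proof.
move=> px pNx; have [[_ [anti _]] _ _ _] := po; apply: anti => //.
by apply/le_pos; rewrite sub0r.
Qed.

Lemma Loc_pos s : Loc s -> pos s.
Proof. by case=> [[p pp ->] _]; apply: posD => //; exact: pos1. Qed.

Lemma Loc1 : Loc 1.
Proof.
split=> [|r]; last by rewrite mulr1.
by exists 0; rewrite ?addr0 // -(mulr0 0); exact: pos_sqr.
Qed.

Lemma LocM s t : Loc s -> Loc t -> Loc (s * t).
Proof.
move=> Ls Lt; have [[p pp sE] hs] := Ls; have [[p' pp' tE] ht] := Lt.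
split=> [|r]; last by rewrite mulrA => /ht/hs.
exists (p + p' + p * p'); last by rewrite sE tE; ring.
by apply: posD; [exact: posD | exact: posM].
Qed.

(** Both r s and -r s are positive, so r and -r are, by cancellation. *)
Lemma Loc_regular r s : Loc s -> r * s = 0 -> r = 0.
Proof.
move=> [_ hs] rs0; have p0 : pos 0 by rewrite -(mulr0 0); exact: pos_sqr.
by apply: pos_antisym; apply: hs; rewrite ?mulNr rs0 ?oppr0.
Qed.

Lemma bdlocE x : bdloc x <-> Loc x.2 /\
  exists n : nat, pos (x.1 + n%:R * x.2) /\ pos (n%:R * x.2 - x.1).
Proof.
have E n : frac_le le (frac_of (- n%:R)) x /\ frac_le le x (frac_of n%:R) <->
    pos (x.1 + n%:R * x.2) /\ pos (n%:R * x.2 - x.1).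
  by rewrite /frac_le /frac_of /= !le_pos !mulr1 mulNr opprK.
by split=> -[Lx [n /E h]]; split=> //; exists n.
Qed.

Lemma frac_le0E x : frac_le le (frac_of 0) x <-> pos x.1.
Proof. by rewrite /frac_le /frac_of /= mul0r mulr1. Qed.

(** * The ordered ring of fractions *)

Section FractionRing.
Variables (L : comPzRingType) (q : frac -> L).
Hypothesis qL : is_localization Loc q.

Let q_surj z : exists2 x, Loc x.2 & q x = z. Proof. by case: qL. Qed.
Let q_eq x y : Loc x.2 -> Loc y.2 -> (q x = q y <-> frac_eq x y).
Proof. by case: qL => _ h _ _ _; exact: h. Qed.
Let qD x y : Loc x.2 -> Loc y.2 -> q (frac_add x y) = q x + q y.
Proof. by case: qL => _ _ h _ _; exact: h. Qed.
Let qM x y : Loc x.2 -> Loc y.2 -> q (frac_mul x y) = q x * q y.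
Proof. by case: qL => _ _ _ h _; exact: h. Qed.

Let P z := exists2 x, Loc x.2 /\ q x = z & pos x.1.

(** Cancellation of elements of [Loc] makes the sign of the numerator independent of the
    representative. *)
Let PE x : Loc x.2 -> P (q x) <-> pos x.1.
Proof.
move=> Lx; split=> [[y [Ly /(q_eq Ly Lx) e] py]|px]; last by exists x.
have [_ hy] := Ly; apply: hy; rewrite -e.
by apply: posM => //; exact: Loc_pos.
Qed.

Let PD z w : P z -> P w -> P (z + w).
Proof.
move=> [x [Lx <-] px] [y [Ly <-] py]; exists (frac_add x y).
  by split; [exact: LocM | exact: qD].
by apply: posD; apply: posM => //; exact: Loc_pos.
Qed.

Let PM z w : P z -> P w -> P (z * w).
Proof.
move=> [x [Lx <-] px] [y [Ly <-] py]; exists (frac_mul x y).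
  by split; [exact: LocM | exact: qM].
exact: posM.
Qed.

Let Psq z : P (z * z).
Proof.
have [x Lx <-] := q_surj z; exists (frac_mul x x).
  by split; [exact: LocM | exact: qM].
exact: pos_sqr.
Qed.

Let q_nat n : q (n%:R, 1) = n%:R.
Proof.
have L1 := Loc1; have q1 : q (1, 1) = 1 by case: qL.
have q0 : q (0, 1) = 0.
  have := @qD (0, 1) (0, 1) L1 L1.
  have -> : frac_add (0, 1) (0, 1) = (0, 1) :> frac.
    by congr pair; rewrite /= ?mulr1 ?addr0.
  by move/eqP; rewrite -subr_eq subrr eq_sym => /eqP.
elim: n => [//|n IH]; rewrite !mulrS -IH -q1 -qD //.
by congr q; congr pair; rewrite /= !mulr1.
Qed.

Let qN x : Loc x.2 -> q (- x.1, x.2) = - q x.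
Proof.
move=> Lx; apply/eqP; rewrite -addr_eq0 -qD //; apply/eqP.
rewrite -[RHS]/(0%:R) -q_nat; apply/q_eq => /=; first exact: LocM.
  exact: Loc1.
by rewrite /frac_eq /=; ring.
Qed.

Let qMn x n : Loc x.2 -> q (x.1 *+ n, x.2) = q x *+ n.
Proof.
move=> Lx; rewrite -[RHS]mulr_natl -q_nat -qM //=; last exact: Loc1.
by congr q; congr pair; rewrite /= ?mul1r // mulr_natl.
Qed.

(** Over a common denominator the hypothesis concerns numerators in the original ring; its
    archimedean property makes x.1 * y.2 positive, and y.2 cancels. *)
Let Parch g h : (forall k, (0 < k)%N -> P (g *+ k + h)) -> P g.
Proof.
have [x Lx <-] := q_surj g; have [y Ly <-] := q_surj h => H.
apply/(PE Lx); have [_ hy] := Ly; apply: hy.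
apply: (arch (h := y.1 * x.2)) => k /H.
rewrite -qMn // -qD // => /PE; rewrite /= mulrnAl; apply.
exact: LocM.
Qed.

Let boundedE x : Loc x.2 -> (bounded P (q x) <-> bdloc x).
Proof.
move=> Lx; rewrite bdlocE /bounded.
have E1 n : P (n%:R + q x) <-> pos (x.1 + n%:R * x.2).
  rewrite -q_nat -qD //; last exact: Loc1.
  rewrite PE /=; first by rewrite mulr1 addrC.
  by apply: LocM => //; exact: Loc1.
have E2 n : P (n%:R - q x) <-> pos (n%:R * x.2 - x.1).
  rewrite -q_nat -qN // -qD //; last exact: Loc1.
  rewrite PE /=; first by rewrite mulr1.
  by apply: LocM => //; exact: Loc1.
split=> [[n [/E1 h1 /E2 h2]]|[_ [n [/E1 h1 /E2 h2]]]]; last by exists n.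
by split=> //; exists n.
Qed.

Lemma bdlocD_loc x y : bdloc x -> bdloc y -> bdloc (frac_add x y).
Proof.
move=> bx bdy; have [Lx _] := bx; have [Ly _] := bdy.
apply/boundedE; first exact: LocM.
by rewrite qD //; apply: boundedD => //; exact/boundedE.
Qed.

Lemma bdlocM_loc x y : bdloc x -> bdloc y -> bdloc (frac_mul x y).
Proof.
move=> bx bdy; have [Lx _] := bx; have [Ly _] := bdy.
apply/boundedE; first exact: LocM.
by rewrite qM //; apply: boundedM => //; exact/boundedE.
Qed.

Lemma exists_character_lt0_loc x : bdloc x -> ~ pos x.1 -> exists2 phi, KR phi & phi x < 0.
Proof.
move=> bx npx; have Lx := bx.1.
have nP : ~ P (q x) by move/(PE Lx).
have bq : bounded P (q x) by exact/boundedE.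
have [phi [phiD phiM phi1 phi0 phix]] :=
  exists_negative_character RR PD PM Psq Parch bq nP.
(* Extension by 0 off the bounded fractions is the normalization required by [character]. *)
pose psi (y : frac) := if pselect (bdloc y) then phi (q y) else 0.
have psiE y : bdloc y -> psi y = phi (q y) by rewrite /psi; case: pselect.
have bd y : bdloc y -> bounded P (q y) by move=> bdy; apply/boundedE => //; exact: bdy.1.
exists psi; last by rewrite psiE.
split.
- by move=> y nby; rewrite /psi; case: pselect.
- move=> y z bdy bz e; rewrite !psiE //; congr phi.
  by apply/q_eq => //; [exact: bdy.1 | exact: bz.1].
- move=> y z bdy bz; rewrite (psiE y) // (psiE z) //; split.
  + rewrite psiE; last exact: bdlocD_loc.
    by rewrite qD ?phiD //; [exact: bd | exact: bd | exact: bdy.1 | exact: bz.1].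
  + rewrite psiE; last exact: bdlocM_loc.
    by rewrite qM ?phiM //; [exact: bd | exact: bd | exact: bdy.1 | exact: bz.1].
- rewrite psiE; first by rewrite (q_nat 1).
  by apply/boundedE; [exact: Loc1 | rewrite (q_nat 1); exact: bounded_nat].
- move=> y bdy /frac_le0E py; rewrite psiE //; apply: phi0; last exact: bd.
  by apply/PE => //; exact: bdy.1.
Qed.

End FractionRing.

Lemma bdlocD x y : bdloc x -> bdloc y -> bdloc (frac_add x y).
Proof.
have [L [q qL]] := localization_exists Loc1 LocM Loc_regular.
exact: bdlocD_loc qL _ _.
Qed.

Lemma bdlocM x y : bdloc x -> bdloc y -> bdloc (frac_mul x y).
Proof.
have [L [q qL]] := localization_exists Loc1 LocM Loc_regular.
exact: bdlocM_loc qL _ _.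
Qed.

Lemma exists_character_lt0 x : bdloc x -> ~ pos x.1 ->
  exists2 phi, KR phi & phi x < 0.
Proof.
have [L [q qL]] := localization_exists Loc1 LocM Loc_regular.
exact: exists_character_lt0_loc qL _.
Qed.

Lemma pos_nat n : pos n%:R.
Proof.
elim: n => [|n IH]; first by rewrite mulr0n -(mulr0 0); exact: pos_sqr.
by rewrite mulrS; apply: posD => //; exact: pos1.
Qed.

Lemma bdloc_int (m : int) : bdloc (frac_of m%:~R).
Proof.
apply/bdlocE; split; first exact: Loc1.
exists `|m|%N; rewrite /= mulr1.
case: m => n /=; rewrite ?NegzE ?mulrNz ?opprK -?pmulrn.
  by rewrite subrr -natrD; split; [exact: pos_nat | exact: (pos_nat 0)].
by rewrite addNr -natrD; split; [exact: (pos_nat 0) | exact: pos_nat].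
Qed.

Lemma bdloc_inv s : Loc s -> bdloc (1, s).
Proof.
move=> Ls; apply/bdlocE; split=> //; exists 1%N; rewrite /= mul1r.
split; first by apply: posD; [exact: pos1 | exact: Loc_pos].
by have [[p pp ->] _] := Ls; rewrite addrAC subrr add0r.
Qed.

(** * Values of characters on fractions *)

Section Character.
Variable phi : frac -> RR.
Hypothesis Kphi : KR phi.

Lemma char_off x : ~ bdloc x -> phi x = 0.
Proof. by case: Kphi => h _ _ _ _; exact: h. Qed.

Lemma char_eq x y : bdloc x -> bdloc y -> x.1 * y.2 = y.1 * x.2 -> phi x = phi y.
Proof. by case: Kphi => _ h _ _ _; exact: h. Qed.

Lemma charD x y : bdloc x -> bdloc y -> phi (frac_add x y) = phi x + phi y.
Proof. by case: Kphi => _ _ h _ _ bx /(h x y bx) []. Qed.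

Lemma charM x y : bdloc x -> bdloc y -> phi (frac_mul x y) = phi x * phi y.
Proof. by case: Kphi => _ _ h _ _ bx /(h x y bx) []. Qed.

Lemma char_ge0 x : bdloc x -> pos x.1 -> 0 <= phi x.
Proof. by case: Kphi => _ _ _ _ h bx /frac_le0E; exact: h. Qed.

Lemma char_int (m : int) : phi (frac_of m%:~R) = m%:~R.
Proof.
have hD (k l : int) :
    phi (frac_of (k + l)%:~R) = phi (frac_of k%:~R) + phi (frac_of l%:~R).
  have [bk bl] := (bdloc_int k, bdloc_int l).
  rewrite -charD //; apply: char_eq; [exact: bdloc_int | exact: bdlocD |].
  by rewrite /= rmorphD /=; ring.
have h0 : phi (frac_of 0%:~R) = 0 by have := hD 0 0; rewrite addr0; lra.
have h1 : phi (frac_of 1%:~R) = 1 by case: Kphi.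
have hn (n : nat) : phi (frac_of n%:~R) = n%:R.
  by elim: n => [//|n IH]; rewrite intS hD h1 IH mulrS.
case: m => n; first by rewrite hn -pmulrn.
have := hD n.+1%:Z (Negz n); rewrite NegzE subrr h0 hn mulrNz -pmulrn; lra.
Qed.

Lemma char_ratio r s t : bdloc (r, s) -> bdloc (r, t) ->
  Loc s -> Loc t -> phi (1, s) * phi (r, t) = phi (1, t) * phi (r, s).
Proof.
move=> brs brt Ls Lt; have [bs bt] := (bdloc_inv Ls, bdloc_inv Lt).
rewrite -!charM //; apply: char_eq; [exact: bdlocM | exact: bdlocM |].
by rewrite /=; ring.
Qed.

End Character.

(** * The topology of the character space and density of the sets {1/s > 0} *)

Lemma KopenI U V : Kopen U -> Kopen V -> Kopen (U `&` V).
Proof.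
move=> [UK hU] [VK hV]; split=> [phi [/UK]//|phi [/hU[xs [e [e0 he]]] /hV[ys [d [d0 hd]]]]].
exists (xs ++ ys), (Num.min e d); split=> [|psi Kpsi h]; first by rewrite lt_min e0.
split; [apply: he | apply: hd] => // x xin; have := h x;
  by rewrite mem_cat xin ?orbT lt_min => /(_ isT)/andP[].
Qed.

Lemma Kopen_KR : Kopen KR.
Proof. by split=> // phi _; exists [::], 1. Qed.

Lemma Kopen_gt x (a : RR) : Kopen [set phi | KR phi /\ a < phi x].
Proof.
split=> [phi []//|phi [_ lt]]; exists [:: x], (phi x - a).
split=> [|psi Kpsi h]; first by rewrite subr_gt0.
split=> //; have := h x; rewrite inE eqxx => /(_ isT).
by rewrite ltr_norml => /andP[]; lra.
Qed.

Lemma Kopen_lt x (a : RR) : Kopen [set phi | KR phi /\ phi x < a].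
Proof.
split=> [phi []//|phi [_ lt]]; exists [:: x], (a - phi x).
split=> [|psi Kpsi h]; first by rewrite subr_gt0.
split=> //; have := h x; rewrite inE eqxx => /(_ isT).
by rewrite ltr_norml => /andP[]; lra.
Qed.

Lemma Kopen_ball phi x (e : RR) : KR phi -> 0 < e -> exists V,
  [/\ Kopen V, V phi & forall psi, V psi -> `|psi x - phi x| < e].
Proof.
move=> Kphi e0; exists ([set psi | KR psi /\ phi x - e < psi x] `&`
  [set psi | KR psi /\ psi x < phi x + e]); split.
- by apply: KopenI; [exact: Kopen_gt | exact: Kopen_lt].
- by split; split=> //; lra.
- by move=> psi [[_ h1] [_ h2]]; rewrite ltr_norml; lra.
Qed.

Lemma Kopen_Os s : Kopen (@Os Rg le RR s).
Proof. exact: Kopen_gt. Qed.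

Lemma dense_in_refl (U : set (frac -> RR)) : dense_in le U U.
Proof. by split=> // V _ [phi [Vphi Uphi]]; exists phi. Qed.

(** The identities for the transform hold on the whole common domain, which then serves as the
    required dense open set. *)
Lemma ae_eq_of_eq (F G : aefun Rg RR) : Kopen F.1 -> Kopen G.1 ->
  (forall phi, F.1 phi -> G.1 phi -> F.2 phi = G.2 phi) -> ae_eq le F G.
Proof.
move=> oF oG h; exists (F.1 `&` G.1); split; first exact: KopenI.
  exact: dense_in_refl.
by move=> phi [Fphi Gphi]; exact: h.
Qed.

(* The nonnegative fraction h approximates, up to the scale N, the squared   *)
(* distance to phi in the coordinates xs.                                    *)
Lemma sum_sqr_fraction (phi : frac -> RR) (N : nat) (xs : seq frac) :
  exists2 h, bdloc h & forall psi, KR psi ->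
    psi h = \sum_(x <- xs | `[< bdloc x >])
              (psi x *+ N - (Num.floor (phi x *+ N))%:~R) ^+ 2.
Proof.
elim: xs => [|x xs [h bh IH]].
  exists (frac_of 0%:~R) => [|psi Kpsi]; first exact: bdloc_int.
  by rewrite big_nil char_int.
have [bx|nbx] := pselect (bdloc x); last first.
  by exists h => // psi Kpsi; rewrite big_cons IH //; case: asboolP.
pose m := Num.floor (phi x *+ N).
pose y := frac_add (frac_mul (frac_of N%:~R) x) (frac_of (- m)%:~R).
have by1 : bdloc (frac_mul (frac_of N%:~R) x).
  by apply: bdlocM => //; exact: bdloc_int.
have bdy : bdloc y by apply: bdlocD => //; exact: bdloc_int.
have byy := bdlocM bdy bdy.
exists (frac_add (frac_mul y y) h) => [|psi Kpsi]; first exact: bdlocD.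
rewrite big_cons asboolT // charD // charM // IH //; congr (_ + _).
have bm := bdloc_int (- m); have bN := bdloc_int N.
by rewrite -expr2 /y charD // charM // !char_int // mulrNz -pmulrn mulr_natl.
Qed.

(** A single inequality M - h > 0 bounds all coordinates at once, h being a sum of squares of N x -
    m. The values phi(x) are real numbers, not fractions, hence their replacement by integers m =
    floor(N phi(x)). Coordinates that are not bounded fractions vanish at every character. *)
Lemma neighbourhood_fraction (phi : frac -> RR) (xs : seq frac) (e : RR) :
  KR phi -> 0 < e -> exists g, [/\ bdloc g, 0 < phi g & forall psi, KR psi ->
    0 < psi g -> forall x, x \in xs -> `|psi x - phi x| < e].
Proof.
move=> Kphi e0; pose M : RR := (size xs)%:R + 1.
have M1 : 1 <= M by rewrite lerDr.
pose N := Num.bound ((M + 1) / e).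
(* At phi each square is below 1, so h < M. Where h < M <= M^2, each N psi(x) is within M of its
   floor, hence within M + 1 < e N of N phi(x). *)
have Ne : M + 1 < e *+ N.
  rewrite -mulr_natr mulrC -ltr_pdivrMr //.
  by apply: archi_boundP; apply: divr_ge0; lra.
have [h bh hE] := sum_sqr_fraction phi N xs.
pose k : int := (size xs).+1.
pose Nh := frac_mul (frac_of (-1)%:~R) h.
have bNh : bdloc Nh by apply: bdlocM => //; exact: bdloc_int.
have bk := bdloc_int k; have bN1 := bdloc_int (-1).
have gE psi : KR psi -> psi (frac_add (frac_of k%:~R) Nh) = M - psi h.
  move=> Kpsi; rewrite charD // charM // !char_int // mulrNz mulN1r.
  by rewrite /M -pmulrn -natr1.
have floorP x : 0 <= phi x *+ N - (Num.floor (phi x *+ N))%:~R < 1.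
  by have := floor_itv (phi x *+ N); rewrite rmorphD /=; lra.
exists (frac_add (frac_of k%:~R) Nh); split; first exact: bdlocD.
  rewrite gE // subr_gt0 hE //.
  apply: (@le_lt_trans _ _ (size xs)%:R); last by rewrite /M ltrDl.
  rewrite -sum1_size natr_sum big_mkcond /=; apply: ler_sum => x _.
  case: ifP => // _; have /andP[h0 h1] := floorP x.
  by rewrite expr_le1 // ltW.
move=> psi Kpsi; rewrite gE // subr_gt0 hE // => lt x xin.
have [bx|nbx] := pselect (bdloc x); last first.
  by rewrite (char_off Kpsi nbx) (char_off Kphi nbx) subrr normr0.
have : (psi x *+ N - (Num.floor (phi x *+ N))%:~R) ^+ 2 < M ^+ 2.
  apply: (@lt_le_trans _ _ M); last by rewrite expr2 ler_peMl //; lra.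
  apply: le_lt_trans lt; rewrite (big_rem x xin) asboolT //= lerDl.
  by apply: sumr_ge0 => y _; exact: sqr_ge0.
have /andP[h0 h1] := floorP x.
have M0 : 0 <= M by lra.
rewrite -real_normK ?num_real // ltr_sqr ?nnegrE //.
rewrite ltr_norml => /andP[l1 l2].
have : `|psi x - phi x| *+ N < e *+ N.
  apply: lt_trans Ne; rewrite -normrMn mulrnBl ltr_norml; lra.
by rewrite ltrMn2r => /andP[].
Qed.

(* On a neighbourhood {g > 0} that misses {1/s > 0} the product g * (1/s)    *)
(* would be nonpositive, hence so would be g, because s is in Loc.           *)
Lemma Os_dense s : Loc s -> dense_in le (@Os Rg le RR s) KR.
Proof.
move=> Ls; split=> [phi []//|V [VK Vo] [phi [Vphi Kphi]]].
have [xs [e [e0 he]]] := Vo phi Vphi.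
have [g [bg g0 hg]] := neighbourhood_fraction xs Kphi e0.
apply: contrapT => noV.
have bs := bdloc_inv Ls; have bN1 := bdloc_int (-1).
pose Ng := frac_mul (frac_of (-1)%:~R) g.
have bNg : bdloc Ng by exact: bdlocM.
have pNg : pos Ng.1.
  (* The factor 1/s does not change the numerator, so -g/s is not positive either; a character
     negative on it makes both 1/s and g positive and would lie in V and in {1/s > 0}. *)
  apply: contrapT => npg.
  have [|psi Kpsi] := @exists_character_lt0 (frac_mul Ng (1, s)) (bdlocM bNg bs).
    by rewrite /= mulr1.
  rewrite !charM // char_int // mulrNz mulN1r mulNr oppr_lt0.
  have s0 : 0 <= psi (1, s) by apply: char_ge0 => //; exact: pos1.
  move=> gs; have s1 : 0 < psi (1, s).
    by rewrite lt_def s0 andbT; apply: contraTneq gs => ->; rewrite mulr0 ltxx.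
  rewrite pmulr_lgt0 // in gs.
  by apply: noV; exists psi; split; [split | apply: he => //; exact: hg].
have := char_ge0 Kphi bNg pNg.
by rewrite charM // char_int // mulrNz mulN1r oppr_ge0 leNgt g0.
Qed.

(** * Continuity, algebra and order of the transform *)

Lemma gel_continuous r s : Loc s -> @Kcont Rg le RR (Os le s) (gel le RR r s).2.
Proof.
move=> Ls phi [Kphi a0] e e0 /=.
set a := phi (1, s) in a0 *; set b := phi (r, s).
(* The bound a/2 keeps a' above a/2, so that e a^2/2 < e a a'; the second bound makes the numerator
   d (a + |b|) smaller than e a^2/2. *)
pose d := Num.min (a / 2) (e * a ^+ 2 / (2 * (a + `|b| + 1))).
have b0 : 0 <= `|b| by [].
have D0 : 0 < 2 * (a + `|b| + 1) by lra.
have d0 : 0 < d.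
  rewrite /d lt_min !divr_gt0 //.
  by rewrite mulr_gt0 // exprn_gt0.
have [U [oU Uphi hU]] := Kopen_ball (1, s) Kphi d0.
have [V [oV Vphi hV]] := Kopen_ball (r, s) Kphi d0.
exists (U `&` V); split=> //; first exact: KopenI.
move=> psi [/hU + /hV +] _; rewrite -/a -/b.
set a' := psi (1, s); set b' := psi (r, s) => h1 h2.
have [da de] : d <= a / 2 /\ d <= e * a ^+ 2 / (2 * (a + `|b| + 1)).
  by apply/andP; rewrite -le_min.
have a'a : a / 2 < a'.
  by move: h1; rewrite ltr_norml => /andP[]; lra.
have a'0 : 0 < a' by lra.
have -> : a'^-1 * b' - a^-1 * b = (a * (b' - b) - b * (a' - a)) / (a * a').
  by field; rewrite !gt_eqF.
rewrite normrM normfV (gtr0_norm (mulr_gt0 a0 a'0)) ltr_pdivrMr ?mulr_gt0 //.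
apply: (@le_lt_trans _ _ (d * (a + `|b|))).
  apply: le_trans (ler_normB _ _) _; rewrite !normrM (gtr0_norm a0) mulrDr.
  by rewrite !(mulrC d); apply: lerD; apply: ler_wpM2l => //; exact: ltW.
apply: (@lt_le_trans _ _ (e * a ^+ 2 / 2)).
  apply: (@lt_le_trans _ _ (d * (a + `|b| + 1))).
    by rewrite ltr_pM2l //; lra.
  move: de; rewrite ler_pdivlMr //; lra.
rewrite expr2 -!mulrA; apply: ler_wpM2l; first exact: ltW.
by apply: ler_wpM2l; lra.
Qed.

Lemma localizable_gelfand_well_defined :
  localizable le -> gelfand_well_defined le RR.
Proof.
move=> locz; split.
- move=> r; have [s [Ls h1 h2]] := locz r; exists s; split=> //.
  (* From -s <= r <= s, the fraction r/s lies between -1 and 1. *)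
  by split=> //; exists 1%N; rewrite /frac_le /= mulr1n !mulr1 mulN1r mul1r.
- move=> r s [Ls brs]; split; [exact: Kopen_Os | exact: Os_dense |].
  exact: gel_continuous.
- move=> r s s' [Ls brs] [Ls' brs']; apply: ae_eq_of_eq.
  + exact: Kopen_Os.
  + exact: Kopen_Os.
  + move=> phi [Kphi a0] [_ a0'] /=.
    have := char_ratio Kphi brs brs' Ls Ls'.
    have na0 := lt0r_neq0 a0; have na0' := lt0r_neq0 a0'.
    move: na0 na0'; set a := phi (1, s); set a' := phi (1, s') => na na' E.
    by apply: (mulfI na); apply: (mulfI na'); rewrite mulVKf // [RHS]mulrCA mulVKf // E.
Qed.

(** Each identity is an equality of bounded fractions after clearing denominators; a character
    preserves it, and its values at 1/s1, 1/s2, 1/s3 are positive on the common domain and can be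
    divided out. *)
Lemma gelfand_is_ring_morphism : gelfand_ring_morphism le RR.
Proof.
split.
- move=> r t s1 s2 s3 [L1 b1] [L2 b2] [L3 b3]; apply: ae_eq_of_eq.
  + exact: Kopen_Os.
  + by apply: KopenI; exact: Kopen_Os.
  + move=> phi [Kphi a3] [[_ a1] [_ a2]] /=.
    have [[i1 i2] i3] := (bdloc_inv L1, bdloc_inv L2, bdloc_inv L3).
    have E : phi (1, s1) * phi (1, s2) * phi (r + t, s3) =
        phi (1, s3) * (phi (r, s1) * phi (1, s2) + phi (t, s2) * phi (1, s1)).
      rewrite -!charM //; do ?exact: bdlocM.
      rewrite -charD //; do ?exact: bdlocM.
      rewrite -!charM //; do ?[exact: bdlocM | apply: bdlocD].
      apply: char_eq => //; do ?[exact: bdlocM | apply: bdlocM | apply: bdlocD] => //.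
      by rewrite /=; ring.
    have := (lt0r_neq0 a1, lt0r_neq0 a2, lt0r_neq0 a3).
    move: E; move: (phi (1, s1)) (phi (1, s2)) (phi (1, s3)) => u v w E [[u0 v0] w0].
    apply: (mulfI (mulf_neq0 (mulf_neq0 u0 v0) w0)).
    have -> : u * v * w * (w^-1 * phi (r + t, s3)) = u * v * phi (r + t, s3) by field.
    by rewrite E; field; apply/andP.
- move=> r t s1 s2 s3 [L1 b1] [L2 b2] [L3 b3]; apply: ae_eq_of_eq.
  + exact: Kopen_Os.
  + by apply: KopenI; exact: Kopen_Os.
  + move=> phi [Kphi a3] [[_ a1] [_ a2]] /=.
    have [[i1 i2] i3] := (bdloc_inv L1, bdloc_inv L2, bdloc_inv L3).
    have E : phi (1, s1) * phi (1, s2) * phi (r * t, s3) =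
        phi (1, s3) * (phi (r, s1) * phi (t, s2)).
      rewrite -!charM //; do ?exact: bdlocM.
      apply: char_eq => //; do ?[exact: bdlocM | apply: bdlocM] => //.
      by rewrite /=; ring.
    have := (lt0r_neq0 a1, lt0r_neq0 a2, lt0r_neq0 a3).
    move: E; move: (phi (1, s1)) (phi (1, s2)) (phi (1, s3)) => u v w E [[u0 v0] w0].
    apply: (mulfI (mulf_neq0 (mulf_neq0 u0 v0) w0)).
    have -> : u * v * w * (w^-1 * phi (r * t, s3)) = u * v * phi (r * t, s3) by field.
    by rewrite E; field; apply/andP.
- move=> s [Ls _]; apply: ae_eq_of_eq; [exact: Kopen_Os | exact: Kopen_KR |].
  by move=> phi [_ a0] _ /=; rewrite mulVf // lt0r_neq0.
Qed.

(** For the converse, a character negative at r/s gives a nonempty open set V = {r/s < 0}. It meets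
    the dense set {1/s > 0}, hence also W, where the transform is both nonnegative and negative. *)
Lemma gelfand_is_order_embedding : gelfand_order_embedding le RR.
Proof.
split=> [r s [Ls brs] pr|r s [Ls brs] [W [oW [WU Wd] hW]]].
  exists (KR `&` Os le s); split.
  - by apply: KopenI; [exact: Kopen_KR | exact: Kopen_Os].
  - exact: dense_in_refl.
  - move=> phi [Kphi [_ a0]] /=; apply: mulr_ge0; first by rewrite invr_ge0 ltW.
    exact: char_ge0.
apply: contrapT => npr.
have [phi Kphi neg] := @exists_character_lt0 (r, s) brs npr.
pose V := [set psi | KR psi /\ psi (r, s) < 0].
have oV : Kopen V by exact: Kopen_lt.
have [_ /(_ V oV)[|psi [Osi [Kpsi Vpsi]]]] := Os_dense Ls; first by exists phi.
have [|chi [Wchi [Kchi Vchi]]] := Wd V oV; first by exists psi.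
have [_ [_ a0]] := WU _ Wchi.
have := hW _ Wchi; rewrite /= leNgt => /negP; apply.
by rewrite nmulr_llt0 // invr_gt0.
Qed.

End Gelfand.

Theorem theorem40 (R : realType) (H : lmodType R[i]) (ip : H -> H -> R[i])
  (D : lmodType R[i]) (j : {linear D -> H}) (A : set (D -> D))
  (hH : is_hilbert ip) (hD : dense_subspace ip j) (hA : comm_star_subalg ip j A)
  (hess : forall a : D -> D, A a -> selfadjoint ip j a ->
            opleq ip j (fun _ => 0) a -> ess_selfadjoint ip j (fun x => x + a x)) :
  let le := Ah_le (hH:=hH) (hA:=hA) in
  [/\ po_comring le, archimedean le, localizable le,
      gelfand_well_defined le R &
      gelfand_ring_morphism le R /\ gelfand_order_embedding le R].
Proof.
have po := Ah_po_comring hH hD hA hess; have arch := @Ah_archimedean R H ip D j A hH hA.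
have locz := Ah_localizable hD hess.
split=> //; first exact: localizable_gelfand_well_defined.
by split; [exact: gelfand_is_ring_morphism | exact: gelfand_is_order_embedding].
Qed.
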